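(* Let $(M,g)$, $n=\dim M>2$, be a Riemannian manifold of constant curvature $\kappa$. Then the scalar curvature $\widetilde r$ of $(T^1_1(M),{}^Sg_f)$ at a point $t$ is $$\widetilde r=\tfrac1f(n-1)\kappa\Big(n-\tfrac1f\|t\|^2\kappa\Big)+\tfrac1{f^2}\kappa^2\big((\mathrm{trace}\,t)^2-\mathrm{trace}(t^2)\big)+{}^fL,$$ where $\|t\|^2=g_{kl}g^{ij}t_i^kt_j^l$ and $${}^fL=\tfrac1f g^{lj}\Big(\nabla_r\big(\tfrac1{2f}{}^fA_{lj}^r\big)-\nabla_l\big(\tfrac1{2f}{}^fA_{rj}^r\big)+\tfrac1{4f^2}{}^fA_{rs}^r\,{}^fA_{lj}^s-\tfrac1{4f^2}{}^fA_{ls}^r\,{}^fA_{rj}^s\Big).$$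
   Context: All objects are smooth; Einstein summation. $f>0$ is a smooth function on $M$. $\nabla$ is the Levi-Civita connection of $g$ with Christoffel symbols $\Gamma_{ij}^h$; $R(\partial_k,\partial_l)\partial_j=R_{klj}{}^{s}\partial_s$ with $R(X,Y)=[\nabla_X,\nabla_Y]-\nabla_{[X,Y]}$. Constant curvature $\kappa$ means $R_{kmj}{}^s=\kappa(\delta_k^sg_{mj}-\delta_m^sg_{kj})$. Ricci tensor $R_{lj}=R_{rlj}{}^r$, scalar curvature is its $g$-trace, and likewise for ${}^Sg_f$. ${}^fA_{ji}^h=f_j\delta_i^h+f_i\delta_j^h-f^hg_{ji}$ with $f_i=\partial_if$, $f^h=g^{hm}f_m$. $T^1_1(M)$ is the bundle of $(1,1)$-tensors, with induced local coordinates $(x^j,t_j^i)$, a point being $t=t_j^i\,\partial_i\otimes dx^j$ at $x$, regarded as an endomorphism of $T_xM$: $\mathrm{trace}\,t=t_c^c$, $\mathrm{trace}(t^2)=t_p^ct_c^p$. The vertical lift of a $(1,1)$-tensor field $A$ is ${}^VA=A_j^i\,\partial/\partial t_j^i$; the horizontal lift of a vector field $X$ is ${}^HX=X^j\partial/\partial x^j+X^s(\Gamma_{sj}^mt_m^i-\Gamma_{sm}^it_j^m)\,\partial/\partial t_j^i$. The rescaled Sasaki type metric is ${}^Sg_f({}^VA,{}^VB)=g_{ic}g^{jl}A_j^iB_l^c$, ${}^Sg_f({}^VA,{}^HY)=0$, ${}^Sg_f({}^HX,{}^HY)=f\,g(X,Y)$. *)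

(* Defs.v *)
From HB Require Import structures.
From mathcomp Require Import all_boot all_order all_algebra.
From mathcomp Require Import all_classical all_reals all_analysis.
From mathcomp Require Import ring.

Set Implicit Arguments.
Unset Strict Implicit.
Unset Printing Implicit Defensive.
Import Order.TTheory GRing.Theory Num.Theory.
Import numFieldNormedType.Exports.
Local Open Scope classical_set_scope.
Local Open Scope ring_scope.

(* Points of R^n are row vectors, and a (0,2)-tensor given in coordinates is a
   function 'rV_n -> 'M_n. *)

Section Calculus.
Context {R : realType} {n : nat}.

Definition partial (i : 'I_n) (F : 'rV[R]_n -> R) : 'rV[R]_n -> R :=
  fun x => 'D_(delta_mx 0 i) F x.

Definition iter_partial (s : seq 'I_n) (F : 'rV[R]_n -> R) : 'rV[R]_n -> R :=
  foldr partial F s.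

(* C^infinity on D, which is open wherever this is used *)
Definition smooth_on (D : set 'rV[R]_n) (F : 'rV[R]_n -> R) : Prop :=
  forall (s : seq 'I_n) x, D x -> differentiable (iter_partial s F) x.

End Calculus.

Section Curvature.
Context {R : realType} {n : nat}.
Implicit Types (g : 'rV[R]_n -> 'M[R]_n) (x : 'rV[R]_n).

(* Gamma_{ij}^h *)
Definition christoffel g (h i j : 'I_n) x : R :=
  2^-1 * \sum_(m < n) invmx (g x) h m *
    (partial i (fun y => g y m j) x + partial j (fun y => g y m i) x
     - partial m (fun y => g y i j) x).

(* R_{klj}^s, with R(d_k, d_l) d_j = R_{klj}^s d_s and
   R(X,Y) = [nabla_X, nabla_Y] - nabla_[X,Y] *)
Definition riemann g (k l j s : 'I_n) x : R :=
  partial k (christoffel g s l j) x - partial l (christoffel g s k j) x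
  + \sum_(a < n) (christoffel g s k a x * christoffel g a l j x
                  - christoffel g s l a x * christoffel g a k j x).

Definition ricci g (l j : 'I_n) x : R := \sum_(r < n) riemann g r l j r x.

Definition scalar_curvature g x : R :=
  \sum_(l < n) \sum_(j < n) invmx (g x) l j * ricci g l j x.

(* (nabla_k S)_{ij}^h for a (1,2)-tensor S, where S h i j stands for S_{ij}^h *)
Definition covd g (S : 'I_n -> 'I_n -> 'I_n -> 'rV[R]_n -> R)
    (k h i j : 'I_n) x : R :=
  partial k (S h i j) x
  + \sum_(a < n) (christoffel g h k a x * S a i j x
                  - christoffel g a k i x * S h a j x
                  - christoffel g a k j x * S h i a x).

(* fA F h j i stands for {}^fA_{ji}^h *)
Definition fA g (F : 'rV[R]_n -> R) (h j i : 'I_n) x : R :=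
  partial j F x * (h == i)%:R + partial i F x * (h == j)%:R
  - (\sum_(m < n) invmx (g x) h m * partial m F x) * g x j i.

Definition fL g (F : 'rV[R]_n -> R) x : R :=
  let S h j i y := (2 * F y)^-1 * fA g F h j i y in
  (F x)^-1 * \sum_(l < n) \sum_(j < n) invmx (g x) l j *
    (\sum_(r < n) covd g S r r l j x
     - \sum_(r < n) covd g S l r r j x
     + \sum_(r < n) \sum_(s < n)
         (4 * F x ^+ 2)^-1 * fA g F r r s x * fA g F s l j x
     - \sum_(r < n) \sum_(s < n)
         (4 * F x ^+ 2)^-1 * fA g F r l s x * fA g F s r j x).

End Curvature.

(* [point_at c] is the inverse of the chart [chart_map c : dom c -> R^n];
   its values outside [chart_map c @` dom c] are irrelevant. *)
Record smoothManifold (R : realType) (n : nat) := SmoothManifold {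
  carrier :> topologicalType;
  chart : Type;
  dom : chart -> set carrier;
  chart_map : chart -> carrier -> 'rV[R]_n;
  point_at : chart -> 'rV[R]_n -> carrier;
  manifold_hausdorff : hausdorff_space carrier;
  manifold_countable : @second_countable carrier;
  chart_cover : forall x, exists c, dom c x;
  chart_dom_open : forall c, open (dom c);
  chart_img_open : forall c, open (chart_map c @` dom c);
  chart_cancel : forall c x, dom c x -> point_at c (chart_map c x) = x;
  chart_continuous : forall c, {within dom c, continuous (chart_map c)};
  chart_inv_continuous :
    forall c, {within chart_map c @` dom c, continuous (point_at c)};
  chart_smooth : forall c d (a : 'I_n),
    smooth_on (chart_map c @` (dom c `&` dom d))
      (fun y => chart_map d (point_at c y) 0 a) }.

Section Manifold.
Context {R : realType} {n : nat}.
Implicit Types (M : smoothManifold R n).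

Definition smooth_function M (f : M -> R) : Prop :=
  forall c : chart M, smooth_on (chart_map c @` dom c) (f \o point_at c).

(* entry (a, b) is d(chart_map d)^a / d(chart_map c)^b at x *)
Definition transition_jacobian M (c d : chart M) (x : M) : 'M[R]_n :=
  \matrix_(a < n, b < n)
    partial b (fun y => chart_map d (point_at c y) 0 a) (chart_map c x).

(* [gmx c y] is the matrix of components g_{ij} in the chart c at the point with
   coordinates y. *)
Record riemMetric M := RiemMetric {
  gmx :> chart M -> 'rV[R]_n -> 'M[R]_n;
  gmx_smooth : forall c (i j : 'I_n),
    smooth_on (chart_map c @` dom c) (fun y => gmx c y i j);
  gmx_sym : forall c y, (chart_map c @` dom c) y -> (gmx c y)^T = gmx c y;
  gmx_pos : forall c y (v : 'rV[R]_n), (chart_map c @` dom c) y -> v != 0 ->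
    0 < (v *m gmx c y *m v^T) 0 0;
  gmx_compat : forall c d x, dom c x -> dom d x ->
    gmx c (chart_map c x) =
      (transition_jacobian c d x)^T *m gmx d (chart_map d x)
      *m transition_jacobian c d x }.

Definition constant_curvature M (g : riemMetric M) (kappa : R) : Prop :=
  forall (c : chart M) y, (chart_map c @` dom c) y ->
  forall k m j s : 'I_n,
    riemann (g c) k m j s y =
      kappa * ((k == s)%:R * g c y m j - (m == s)%:R * g c y k j).

(* A point of T^1_1(M): a base point x and an endomorphism of T_xM, given by its
   matrix in each chart around x (row i, column j holds t_j^i). *)
Record tensor11 M := Tensor11 {
  tbase : M;
  tcomp : forall c : chart M, dom c tbase -> 'M[R]_n;
  tcomp_compat : forall (c d : chart M) (hc : dom c tbase)
      (hd : dom d tbase),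
    tcomp hd *m transition_jacobian c d tbase =
      transition_jacobian c d tbase *m tcomp hc }.

(* Coordinates (x^j, t_j^i) on T^1_1(M), as a vector of R^(n + n * n). *)
Definition bundle_coord (x : 'rV[R]_n) (t : 'M[R]_n) : 'rV[R]_(n + n * n) :=
  row_mx x (mxvec t).

Definition induced_coord M (t : tensor11 M) (c : chart M)
    (hc : dom c (tbase t)) : 'rV[R]_(n + n * n) :=
  bundle_coord (chart_map c (tbase t)) (tcomp hc).

(* The lifts at (x, t) depend on the lifted fields through their values at x
   only: A is the matrix (A_j^i) and X the row (X^j) of these values. *)
Definition vlift (A : 'M[R]_n) : 'rV[R]_(n + n * n) := row_mx 0 (mxvec A).

Definition hlift (g : 'rV[R]_n -> 'M[R]_n) (x : 'rV[R]_n) (t : 'M[R]_n)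
    (X : 'rV[R]_n) : 'rV[R]_(n + n * n) :=
  row_mx X (mxvec (\matrix_(i < n, j < n) \sum_(s < n) X 0 s *
    (\sum_(m < n) (christoffel g m s j x * t i m
                   - christoffel g i s m x * t m j)))).

(* G c is the matrix of the rescaled Sasaki type metric in the coordinates of
   T^1_1(M) induced by c. As the lifts span the tangent space at each point,
   these conditions determine G c over the domain of c; see
   [rescaled_sasaki_exists] and [rescaled_sasaki_unique]. *)
Definition rescaled_sasaki M (g : riemMetric M) (f : M -> R)
    (G : chart M -> 'rV[R]_(n + n * n) -> 'M[R]_(n + n * n)) : Prop :=
  forall (c : chart M) (x : 'rV[R]_n) (t : 'M[R]_n), (chart_map c @` dom c) x ->
  let gx := g c x in
  let Gp u v := (u *m G c (bundle_coord x t) *m v^T) 0 0 in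
  [/\ forall u v, Gp u v = Gp v u,
      forall A B : 'M[R]_n, Gp (vlift A) (vlift B) =
        \sum_(i < n) \sum_(j < n) \sum_(k < n) \sum_(l < n)
          gx i k * invmx gx j l * A i j * B k l,
      forall (A : 'M[R]_n) (Y : 'rV[R]_n),
        Gp (vlift A) (hlift (g c) x t Y) = 0
    & forall X Y : 'rV[R]_n,
        Gp (hlift (g c) x t X) (hlift (g c) x t Y) =
          f (point_at c x) * (X *m gx *m Y^T) 0 0].

Local Lemma exchange_sum4 (F : 'I_n -> 'I_n -> 'I_n -> 'I_n -> R) :
  \sum_i \sum_j \sum_k \sum_l F i j k l = \sum_k \sum_l \sum_i \sum_j F i j k l.
Proof.
transitivity (\sum_i \sum_k \sum_l \sum_j F i j k l).
  apply: eq_bigr => i _; rewrite exchange_big; apply: eq_bigr => k _.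
  exact: exchange_big.
by rewrite exchange_big; apply: eq_bigr => k _; rewrite exchange_big.
Qed.

Local Lemma mxvec_dot (A B : 'M[R]_n) :
  (mxvec A *m (mxvec B)^T) 0 0 = \sum_(i < n) \sum_(j < n) A i j * B i j.
Proof.
rewrite mxE pair_bigA (reindex _ (curry_mxvec_bij _ _)) /=.
by apply: eq_bigr => -[i j] _; rewrite mxE !mxvecE.
Qed.

Local Lemma hliftE g x t X : hlift g x t X = row_mx X (X *m \matrix_(s < n)
  mxvec (\matrix_(i < n, j < n) \sum_(m < n)
    (christoffel g m s j x * t i m - christoffel g i s m x * t m j))).
Proof.
congr row_mx; apply/rowP => k; case/mxvec_indexP: k => i j.
rewrite mxvecE !mxE; apply: eq_bigr => s _.
by rewrite !mxE mxvecE !mxE.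
Qed.

Local Lemma mx_sym_bform m (P : 'M[R]_m) :
  P^T = P <-> forall u v : 'rV[R]_m, (u *m P *m v^T) 0 0 = (v *m P *m u^T) 0 0.
Proof.
split=> [Ps u v|Ps].
  suff -> : v *m P *m u^T = (u *m P *m v^T)^T by rewrite [RHS]mxE.
  by rewrite !trmx_mul trmxK Ps mulmxA.
apply/matrixP => i j; rewrite mxE.
have := Ps (delta_mx 0 j) (delta_mx 0 i).
by rewrite -!rowE !trmx_delta -!colE !mxE.
Qed.

Lemma rescaled_sasaki_exists M (g : riemMetric M) (f : M -> R) :
  exists G, rescaled_sasaki g f G.
Proof.
pose Hm c x t := \matrix_(s < n) mxvec (\matrix_(i < n, j < n) \sum_(m < n)
  (christoffel (g c) m s j x * t i m - christoffel (g c) i s m x * t m j)).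
pose K c x := lin_mx (mulmxr (invmx (g c x)) \o mulmx (g c x)) : 'M[R]_(n * n).
exists (fun c p =>
  let x := lsubmx p in let t := vec_mx (rsubmx p) in
  let h := Hm c x t in let k := K c x in
  block_mx (f (point_at c x) *: g c x + h *m k *m h^T) (- (h *m k))
           (- (k *m h^T)) k).
move=> c x t xc gx Gp.
have gS : gx^T = gx by apply: gmx_sym.
have gE i j : gx i j = gx j i by rewrite -{1}gS mxE.
have giE i j : invmx gx i j = invmx gx j i by rewrite -{1}gS -trmx_inv mxE.
have KE (A B : 'M[R]_n) : (mxvec A *m K c x *m (mxvec B)^T) 0 0 =
    \sum_(i < n) \sum_(j < n) \sum_(k < n) \sum_(l < n)
          gx i k * invmx gx j l * A i j * B k l.
  rewrite mul_vec_lin mxvec_dot /=.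
  transitivity (\sum_(k < n) \sum_(l < n) \sum_(i < n) \sum_(j < n)
          gx i k * invmx gx j l * A i j * B k l).
    apply: eq_bigr => a _; apply: eq_bigr => b _.
    rewrite mxE big_distrl exchange_big /=; apply: eq_bigr => j _.
    rewrite mxE !big_distrl /=; apply: eq_bigr => i _.
    by rewrite (gE i a) /gx; ring.
  exact: exchange_sum4.
have KS : (K c x)^T = K c x.
  apply/mx_sym_bform => u v; rewrite -[u]vec_mxK -[v]vec_mxK !KE.
  rewrite exchange_sum4; apply: eq_bigr => i _; apply: eq_bigr => j _.
  apply: eq_bigr => k _; apply: eq_bigr => l _.
  by rewrite (gE k i) (giE l j); ring.
rewrite /Gp /bundle_coord row_mxKl row_mxKr mxvecK {}/Gp.
split=> [|A B|A Y|X Y].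
- apply/mx_sym_bform; rewrite tr_block_mx !linearN !linearD /= linearZ /= gS.
  by rewrite !trmx_mul !trmxK !KS mulmxA.
- by rewrite tr_row_mx mul_row_block mul_row_col !mul0mx trmx0 mulmx0 !add0r KE.
- rewrite hliftE -/(Hm c x t) tr_row_mx mul_row_block mul_row_col !mul0mx !add0r.
  by rewrite mulmxN mulNmx trmx_mul !mulmxA addNr mxE.
rewrite !hliftE -/(Hm c x t) !tr_row_mx mul_row_block mul_row_col.
rewrite !mulmxN !mulmxDr !mulmxA addrK addNr mul0mx addr0.
by rewrite -scalemxAr -scalemxAl mxE.
Qed.

Lemma rescaled_sasaki_unique M (g : riemMetric M) (f : M -> R) G G' :
  rescaled_sasaki g f G -> rescaled_sasaki g f G' ->
  forall (c : chart M) x t, (chart_map c @` dom c) x ->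
    G c (bundle_coord x t) = G' c (bundle_coord x t).
Proof.
move=> hG hG' c x t xc.
have [S1 V1 O1 H1] := hG c x t xc; have [S2 V2 O2 H2] := hG' c x t xc.
have split_lift (u : 'rV[R]_(n + n * n)) :
    exists X A, u = hlift (g c) x t X + vlift A.
  pose w := hlift (g c) x t (lsubmx u).
  exists (lsubmx u), (vec_mx (rsubmx u - rsubmx w)).
  rewrite /vlift vec_mxK -/w -{1}[w]hsubmxK add_row_mx addr0 subrKC.
  by rewrite [lsubmx w]row_mxKl hsubmxK.
have E (u v : 'rV[R]_(n + n * n)) : (u *m G c (bundle_coord x t) *m v^T) 0 0 =
             (u *m G' c (bundle_coord x t) *m v^T) 0 0.
  have [X [A ->]] := split_lift u; have [Y [B ->]] := split_lift v.
  have D (P : 'M[R]_(n + n * n)) (p q r s : 'rV[R]_(n + n * n)) :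
      ((p + q) *m P *m (r + s)^T) 0 0 =
      (p *m P *m r^T) 0 0 + (p *m P *m s^T) 0 0
      + ((q *m P *m r^T) 0 0 + (q *m P *m s^T) 0 0).
    have mxD (U V : 'M[R]_1) : (U + V) 0 0 = U 0 0 + V 0 0 by rewrite mxE.
    by rewrite linearD /= !mulmxDr !mulmxDl !mxD; ring.
  rewrite !D (S1 (hlift _ _ _ _) (vlift _)) (S2 (hlift _ _ _ _) (vlift _)).
  by rewrite !(V1, V2, O1, O2, H1, H2).
apply/matrixP => i j; have := E (delta_mx 0 i) (delta_mx 0 j).
by rewrite -!rowE !trmx_delta -!colE !mxE.
Qed.

End Manifold.

(* Main.v *)
Require Import Defs.
From HB Require Import structures.
From mathcomp Require Import all_boot all_order all_algebra.
From mathcomp Require Import all_classical all_reals all_analysis.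
From mathcomp Require Import ring.
Set Implicit Arguments.
Unset Strict Implicit.
Unset Printing Implicit Defensive.
Import Order.TTheory GRing.Theory Num.Theory.
Import numFieldNormedType.Exports.
Local Open Scope classical_set_scope.
Local Open Scope ring_scope.

(** Why the formula holds. The metric g makes the fibres of T^1_1(M) Euclidean,
    with <A, B> = tr (g^-1 A^T g B), and its Levi-Civita connection induces a
    linear connection on T^1_1(M) for which this fibre metric is parallel. The
    rescaled Sasaki type metric is the one for which horizontal and vertical
    spaces are orthogonal, the fibres carry < , > and horizontal vectors are
    measured by f g. Thus the projection to (M, f g) is a Riemannian submersion
    with flat, totally geodesic fibres, and O'Neill's formula reads

      scal G = scal (f g) - 1/4 sum h^ij h^kl <F_ik t, F_jl t>,

    with h = f g and F_ik t = t R_ik - R_ik t, where R_ik is the curvature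
    endomorphism of g ([scalar_curvature_bundle], [mul_bundle_curv]).

    - In constant curvature R_ik is kappa times the antisymmetrization of
      e_i e_k^T g, and the contraction over i, j, k, l consists of traces of
      products of t, t^T, g and g^-1. It is
      4 kappa^2 ((n - 1) |t|^2 - (tr t)^2 + tr (t^2)), divided by f^2
      ([contract_curvature]).
    - The Christoffel symbols of f g differ from those of g by fA / (2 f), which
      yields scal (f g) = scal g / f + fL ([scalar_curvature_scale]), and
      scal g = n (n - 1) kappa.

    O'Neill's formula is proved for an arbitrary vector bundle in a
    trivialization, with fibre coordinates v in R^m, connection matrices b_i and
    a parallel fibre metric K. In the frame made of the horizontal lifts and the
    vertical coordinate fields, the metric is block diagonal and depends on the
    base point only. The Levi-Civita connection is written down in this frame
    and recognised from metricity and absence of torsion ([conn_unique]); its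
    scalar curvature is then computed from its frame components
    ([scalar_curvature_frame]).

    Except where endomorphisms act on them, tangent vectors are rows, so that a
    connection along d_k is a matrix acting on the right. *)

(** * Smooth functions and their partial derivatives *)

Lemma near_eq_differentiable (K : numFieldType) (V W : normedModType K)
    (F G : V -> W) (x : V) :
  (\near x, F x = G x) -> differentiable G x -> differentiable F x.
Proof.
move=> FG dG; have dGc : continuous ('d G x) by exact: diff_continuous.
have e : F \o shift x = cst (F x) + 'd G x +o_ 0 id.
  apply/eqaddoP => eps eps0.
  have /eqaddoP/(_ eps eps0) G_o := diff_locally dG.
  have FG0 : \forall h \near 0, F (h + x) = G (h + x).
    move: FG; rewrite (near_shift 0) /= subr0 => FG.
    by near=> h; near: h; exact: FG.
  apply: filterS2 FG0 G_o => h Fh; rewrite !fctE /=.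
  by rewrite Fh (nbhs_singleton FG).
by apply/diff_locallyP; rewrite (diff_unique dGc e).
Unshelve. all: by end_near. Qed.

Section SmoothFunctions.
Context {R : realType} {n : nat}.
Implicit Types (D : set 'rV[R]_n) (F G : 'rV[R]_n -> R).

Lemma open_near_eq D F G x :
  open D -> {in D, F =1 G} -> D x -> \near x, F x = G x.
Proof.
move=> oD FG Dx; apply: filterS (open_nbhs_nbhs (conj oD Dx)) => y Dy.
by apply: FG; rewrite inE.
Qed.

Lemma eq_partial_in D F G i :
  open D -> {in D, F =1 G} -> {in D, partial i F =1 partial i G}.
Proof.
move=> oD FG x /set_mem Dx; apply: near_eq_derive; exact: open_near_eq FG Dx.
Qed.

Lemma partialD F G i x : differentiable F x -> differentiable G x ->
  partial i (fun y => F y + G y) x = partial i F x + partial i G x.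
Proof. by move=> dF dG; apply: deriveD; exact: diff_derivable. Qed.

Lemma partialM F G i x : differentiable F x -> differentiable G x ->
  partial i (fun y => F y * G y) x = partial i F x * G x + F x * partial i G x.
Proof.
move=> dF dG; rewrite addrC [_ * G x]mulrC.
by apply: deriveM; exact: diff_derivable.
Qed.

Lemma partialV F i x : differentiable F x -> F x != 0 ->
  partial i (fun y => (F y)^-1) x = - partial i F x * ((F x)^-1 * (F x)^-1).
Proof.
move=> dF F0; rewrite /partial deriveV //; last exact: diff_derivable.
by rewrite -exprVn expr2 /GRing.scale /= mulNr mulrC mulNr.
Qed.

Lemma partial_cst (a : R) i x : partial i (fun _ : 'rV[R]_n => a) x = 0.
Proof. exact: derive_cst. Qed.

Lemma partial_sum (I : Type) (r : seq I) (P : pred I)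
    (F : I -> 'rV[R]_n -> R) i x :
  (forall a, differentiable (F a) x) ->
  partial i (fun y => \sum_(a <- r | P a) F a y) x =
  \sum_(a <- r | P a) partial i (F a) x.
Proof.
move=> dF; elim: r => [|a r IH].
  rewrite big_nil -[RHS](partial_cst 0 i x); congr partial.
  by apply/funext => y; rewrite big_nil.
rewrite big_cons -IH.
have dS : differentiable (fun y => \sum_(b <- r | P b) F b y) x.
  elim: {IH} r => [|b r IH].
    rewrite (_ : (fun _ => _) = cst 0); first exact: differentiable_cst.
    by apply/funext => y; rewrite big_nil.
  case Pb: (P b); last first.
    by under [X in differentiable X _]funext do rewrite big_cons Pb.
  under [X in differentiable X _]funext do rewrite big_cons Pb.
  exact: differentiableD.
case Pa: (P a); last first.
  by congr partial; apply/funext => y; rewrite big_cons Pa.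
rewrite -partialD //; congr partial.
by apply/funext => y; rewrite big_cons Pa.
Qed.

(** Finite-order smoothness, peeling off the first derivative instead of the
    last one as iterated partial derivatives do: the Leibniz and quotient rules
    then allow an induction on the order, which the unbounded notion does not. *)
Fixpoint ck (k : nat) D F : Prop :=
  (forall x, D x -> differentiable F x) /\
  if k is k'.+1 then forall i, ck k' D (partial i F) else True.

Lemma ck_diff k D F x : ck k D F -> D x -> differentiable F x.
Proof. by case: k => [|k] [dF _] /dF. Qed.

Lemma ckW k D F : ck k.+1 D F -> ck k D F.
Proof.
elim: k F => [|k IH] F /= [dF cF]; split => // i.
by apply: IH; exact: cF.
Qed.

Lemma smooth_onP D F : smooth_on D F <-> forall k, ck k D F.
Proof.
split=> [sF k|cF].
  elim: k F sF => [|k IH] F sF; split=> //; try exact: (sF [::]).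
  move=> i; apply: IH => s x Dx; have := sF (rcons s i) x Dx.
  by rewrite /iter_partial foldr_rcons.
move=> s; elim/last_ind: s F cF => [|s i IH] F cF x Dx.
  exact: ck_diff (cF 0%N) Dx.
rewrite /iter_partial foldr_rcons; apply: IH Dx => k.
by have /= [_] := cF k.+1; exact.
Qed.

Lemma eq_ck k D F G : open D -> {in D, F =1 G} -> ck k D G -> ck k D F.
Proof.
move=> oD; have dE F' G' : {in D, F' =1 G'} ->
    (forall x, D x -> differentiable G' x) ->
    forall x, D x -> differentiable F' x.
  move=> FG dG x Dx; apply: near_eq_differentiable (dG x Dx).
  exact: open_near_eq FG Dx.
elim: k F G => [|k IH] F G FG /= [dG cG]; split; try exact: dE FG dG.
  by [].
by move=> i; apply: IH (cG i); exact: eq_partial_in.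
Qed.

Lemma ckD k D F G : open D -> ck k D F -> ck k D G ->
  ck k D (fun y => F y + G y).
Proof.
move=> oD; elim: k F G => [|k IH] F G /= [dF cF] [dG cG]; split => //;
  try by move=> x Dx; apply: differentiableD; [exact: dF|exact: dG].
move=> i; apply: eq_ck (IH _ _ (cF i) (cG i)) => // x /set_mem Dx.
by apply: partialD; [exact: dF|exact: dG].
Qed.

Lemma ckM k D F G : open D -> ck k D F -> ck k D G ->
  ck k D (fun y => F y * G y).
Proof.
move=> oD; elim: k F G => [|k IH] F G cF cG; (split => //;
  first by move=> x Dx; apply: differentiableM; [exact: ck_diff cF Dx|
    exact: ck_diff cG Dx]).
move=> i; have [_ cF'] := cF; have [_ cG'] := cG.
apply: eq_ck (ckD oD (IH _ _ (cF' i) (ckW cG)) (IH _ _ (ckW cF) (cG' i))) => //.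
by move=> x /set_mem Dx; apply: partialM; [exact: ck_diff cF Dx|
  exact: ck_diff cG Dx].
Qed.

Lemma ck_cst k D (a : R) : ck k D (fun=> a).
Proof.
elim: k a => [|k IH] a; split=> // i; rewrite (_ : partial i _ = (fun=> 0));
  first exact: IH.
by apply/funext => x; exact: partial_cst.
Qed.

(** The inverse reappears in its own derivative - F' / F^2, but one order of
    smoothness lower, so that induction on the order closes the loop. *)
Lemma ckV k D F : open D -> (forall x, D x -> F x != 0) -> ck k D F ->
  ck k D (fun y => (F y)^-1).
Proof.
move=> oD F0; elim: k => [|k IH] cF; (split => //;
  first by move=> x Dx; apply: differentiableV; [exact: ck_diff cF Dx|exact: F0]).
move=> i; have [_ cF'] := cF; have IHF := IH (ckW cF).
apply: eq_ck (ckM oD (ckM oD (ck_cst k D (-1)) (cF' i)) (ckM oD IHF IHF)) => //.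
move=> x /set_mem Dx; rewrite partialV ?mulN1r //; last exact: F0.
exact: ck_diff cF Dx.
Qed.

End SmoothFunctions.

Section SmoothClosure.
Context {R : realType} {n : nat} (D : set 'rV[R]_n) (oD : open D).
Implicit Types (F G : 'rV[R]_n -> R).

Lemma smooth_on_diff F x : smooth_on D F -> D x -> differentiable F x.
Proof. by move=> sF; apply: (sF [::]). Qed.

Lemma smooth_on_partial i F : smooth_on D F -> smooth_on D (partial i F).
Proof. by move=> sF s x Dx; have := sF (rcons s i) x Dx;
  rewrite /iter_partial foldr_rcons. Qed.

Lemma eq_smooth_on F G : {in D, F =1 G} -> smooth_on D G -> smooth_on D F.
Proof. by move=> FG /smooth_onP cG; apply/smooth_onP => k;
  exact: eq_ck FG (cG k). Qed.

Lemma smooth_on_cst (a : R) : smooth_on D (fun=> a).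
Proof. by apply/smooth_onP => k; exact: ck_cst. Qed.

Lemma smooth_onD F G : smooth_on D F -> smooth_on D G ->
  smooth_on D (fun y => F y + G y).
Proof. by move=> /smooth_onP cF /smooth_onP cG; apply/smooth_onP => k;
  exact: ckD. Qed.

Lemma smooth_onM F G : smooth_on D F -> smooth_on D G ->
  smooth_on D (fun y => F y * G y).
Proof. by move=> /smooth_onP cF /smooth_onP cG; apply/smooth_onP => k;
  exact: ckM. Qed.

Lemma smooth_onV F : (forall x, D x -> F x != 0) -> smooth_on D F ->
  smooth_on D (fun y => (F y)^-1).
Proof. by move=> F0 /smooth_onP cF; apply/smooth_onP => k; exact: ckV. Qed.

Lemma smooth_onN F : smooth_on D F -> smooth_on D (fun y => - F y).
Proof.
move=> sF; rewrite (_ : (fun _ => _) = fun y => -1 * F y).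
  exact/smooth_onM/sF/smooth_on_cst.
by apply/funext => y; rewrite mulN1r.
Qed.

Lemma smooth_on_sum (I : Type) (r : seq I) (P : pred I) (F : I -> 'rV[R]_n -> R) :
  (forall a, smooth_on D (F a)) -> smooth_on D (fun y => \sum_(a <- r | P a) F a y).
Proof.
move=> sF; elim: r => [|a r IH].
  by rewrite (_ : (fun _ => _) = fun=> 0);
    [exact: smooth_on_cst|apply/funext => y; rewrite big_nil].
under [X in smooth_on D X]funext do rewrite big_cons.
by case: (P a) => //; exact: smooth_onD.
Qed.

Lemma smooth_on_prod (I : Type) (r : seq I) (P : pred I) (F : I -> 'rV[R]_n -> R) :
  (forall a, smooth_on D (F a)) ->
    smooth_on D (fun y => \prod_(a <- r | P a) F a y).
Proof.
move=> sF; elim: r => [|a r IH].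
  by rewrite (_ : (fun _ => _) = fun=> 1);
    [exact: smooth_on_cst|apply/funext => y; rewrite big_nil].
under [X in smooth_on D X]funext do rewrite big_cons.
by case: (P a) => //; exact: smooth_onM.
Qed.

Lemma partial_coord (i j : 'I_n) x :
  partial i (fun y : 'rV[R]_n => y 0 j) x = (j == i)%:R.
Proof.
have := derive_mx (@derivable_id R 'rV[R]_n x (delta_mx 0 i)).
by rewrite derive_id => /matrixP/(_ 0 j); rewrite !mxE eqxx.
Qed.

Lemma smooth_on_coord i : smooth_on D (fun y => y 0 i).
Proof.
have dC x : differentiable (fun y : 'rV[R]_n => y 0 i) x.
  exact: differentiable_coord.
apply/smooth_onP => -[|k]; split => // j.
rewrite (_ : partial j _ = (fun=> (i == j)%:R)); first exact: ck_cst.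
by apply/funext => x; exact: partial_coord.
Qed.

End SmoothClosure.

(** * Matrix-valued functions *)

Section MatrixCalculus.
Context {R : realType} {n : nat} (D : set 'rV[R]_n) (oD : open D).

Definition smooth_mx p q (A : 'rV[R]_n -> 'M[R]_(p, q)) : Prop :=
  forall i j, smooth_on D (fun y => A y i j).

Definition pmx p q (k : 'I_n) (A : 'rV[R]_n -> 'M[R]_(p, q)) x : 'M[R]_(p, q) :=
  \matrix_(i, j) partial k (fun y => A y i j) x.

Implicit Types (p q r : nat).

Lemma smooth_mx_diff p q (A : 'rV[R]_n -> 'M[R]_(p, q)) x i j :
  smooth_mx A -> D x -> differentiable (fun y => A y i j) x.
Proof. by move=> sA; exact/smooth_on_diff. Qed.

Lemma smooth_mx_pmx p q k (A : 'rV[R]_n -> 'M[R]_(p, q)) :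
  smooth_mx A -> smooth_mx (pmx k A).
Proof.
move=> sA i j; under [X in smooth_on D X]funext do rewrite mxE.
exact: smooth_on_partial.
Qed.

Lemma eq_smooth_mx p q (A B : 'rV[R]_n -> 'M[R]_(p, q)) :
  {in D, A =1 B} -> smooth_mx B -> smooth_mx A.
Proof.
by move=> AB sB i j; apply: (eq_smooth_on oD) (sB i j) => x Dx; rewrite AB.
Qed.

Lemma eq_pmx_in p q k (A B : 'rV[R]_n -> 'M[R]_(p, q)) :
  {in D, A =1 B} -> {in D, pmx k A =1 pmx k B}.
Proof.
move=> AB x Dx; apply/matrixP => i j; rewrite !mxE.
by apply: (eq_partial_in _ oD) Dx => y Dy; rewrite AB.
Qed.

Lemma smooth_mx_cst p q (A : 'M[R]_(p, q)) : smooth_mx (fun=> A).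
Proof. by move=> i j; exact: smooth_on_cst. Qed.

Lemma pmx_cst p q k (A : 'M[R]_(p, q)) x : pmx k (fun=> A) x = 0.
Proof. by apply/matrixP => i j; rewrite !mxE partial_cst. Qed.

Lemma smooth_mxD p q (A B : 'rV[R]_n -> 'M[R]_(p, q)) :
  smooth_mx A -> smooth_mx B -> smooth_mx (fun y => A y + B y).
Proof.
move=> sA sB i j; under [X in smooth_on D X]funext do rewrite mxE.
exact: (smooth_onD oD).
Qed.

Lemma smooth_mxN p q (A : 'rV[R]_n -> 'M[R]_(p, q)) :
  smooth_mx A -> smooth_mx (fun y => - A y).
Proof.
move=> sA i j; under [X in smooth_on D X]funext do rewrite mxE.
exact: (smooth_onN oD (sA i j)).
Qed.

Lemma smooth_mxB p q (A B : 'rV[R]_n -> 'M[R]_(p, q)) :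
  smooth_mx A -> smooth_mx B -> smooth_mx (fun y => A y - B y).
Proof. by move=> sA sB; exact: (smooth_mxD sA (smooth_mxN sB)). Qed.

Lemma pmxD p q k (A B : 'rV[R]_n -> 'M[R]_(p, q)) x :
  smooth_mx A -> smooth_mx B -> D x ->
  pmx k (fun y => A y + B y) x = pmx k A x + pmx k B x.
Proof.
move=> sA sB Dx; apply/matrixP => i j; rewrite !mxE.
under [X in partial k X]funext do rewrite mxE.
by rewrite partialD //; exact: smooth_mx_diff Dx.
Qed.

Lemma smooth_mx_sum p q (I : Type) (s : seq I) (P : pred I)
    (A : I -> 'rV[R]_n -> 'M[R]_(p, q)) :
  (forall a, smooth_mx (A a)) -> smooth_mx (fun y => \sum_(a <- s | P a) A a y).
Proof.
move=> sA i j; under [X in smooth_on D X]funext do rewrite summxE.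
by apply: (smooth_on_sum oD) => a; exact: sA.
Qed.

Lemma pmx_sum p q k (I : Type) (s : seq I) (P : pred I)
    (A : I -> 'rV[R]_n -> 'M[R]_(p, q)) x :
  (forall a, smooth_mx (A a)) -> D x ->
  pmx k (fun y => \sum_(a <- s | P a) A a y) x = \sum_(a <- s | P a) pmx k (A a) x.
Proof.
move=> sA Dx; apply/matrixP => i j; rewrite mxE summxE.
under [X in partial k X]funext do rewrite summxE.
rewrite partial_sum => [|a]; last exact: smooth_mx_diff Dx.
by apply: eq_bigr => a _; rewrite mxE.
Qed.

Lemma smooth_mxZ p q (F : 'rV[R]_n -> R) (A : 'rV[R]_n -> 'M[R]_(p, q)) :
  smooth_on D F -> smooth_mx A -> smooth_mx (fun y => F y *: A y).
Proof.
move=> sF sA i j; under [X in smooth_on D X]funext do rewrite mxE.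
exact: (smooth_onM oD).
Qed.

Lemma pmxZ p q k (F : 'rV[R]_n -> R) (A : 'rV[R]_n -> 'M[R]_(p, q)) x :
  smooth_on D F -> smooth_mx A -> D x ->
  pmx k (fun y => F y *: A y) x = partial k F x *: A x + F x *: pmx k A x.
Proof.
move=> sF sA Dx; apply/matrixP => i j; rewrite !mxE.
under [X in partial k X]funext do rewrite mxE.
by rewrite partialM //; [exact: smooth_on_diff Dx|exact: smooth_mx_diff Dx].
Qed.

Lemma smooth_mxM p q r (A : 'rV[R]_n -> 'M[R]_(p, q))
  (B : 'rV[R]_n -> 'M[R]_(q, r)) :
  smooth_mx A -> smooth_mx B -> smooth_mx (fun y => A y *m B y).
Proof.
move=> sA sB i j; under [X in smooth_on D X]funext do rewrite mxE.
by apply: (smooth_on_sum oD) => a; exact: (smooth_onM oD).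
Qed.

Lemma pmxM p q r k (A : 'rV[R]_n -> 'M[R]_(p, q)) (B : 'rV[R]_n -> 'M[R]_(q, r)) x :
  smooth_mx A -> smooth_mx B -> D x ->
  pmx k (fun y => A y *m B y) x = pmx k A x *m B x + A x *m pmx k B x.
Proof.
move=> sA sB Dx; apply/matrixP => i j; rewrite !mxE -big_split /=.
have dA a := smooth_mx_diff i a sA Dx; have dB a := smooth_mx_diff a j sB Dx.
under [X in partial k X]funext do rewrite mxE.
rewrite partial_sum => [|a]; last by apply: differentiableM.
by apply: eq_bigr => a _; rewrite partialM // !mxE.
Qed.

(** Reduces the differentiation of any linear function of a matrix (transpose,
    reshaping into a row, commutator) to the differentiation of its entries. *)
Lemma linear_mx_sum p q r s (L : {linear 'M[R]_(p, q) -> 'M[R]_(r, s)})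
  (A : 'M[R]_(p, q)) :
  L A = \sum_a \sum_b A a b *: L (delta_mx a b).
Proof.
rewrite {1}[A]matrix_sum_delta linear_sum; apply: eq_bigr => a _.
by rewrite linear_sum; apply: eq_bigr => b _; rewrite linearZ.
Qed.

Lemma smooth_mx_lin p q r s (L : {linear 'M[R]_(p, q) -> 'M[R]_(r, s)})
    (A : 'rV[R]_n -> 'M[R]_(p, q)) :
  smooth_mx A -> smooth_mx (fun y => L (A y)).
Proof.
move=> sA; rewrite (funext (fun y => linear_mx_sum L (A y))).
apply: smooth_mx_sum => a; apply: smooth_mx_sum => b.
exact/smooth_mxZ/smooth_mx_cst.
Qed.

Lemma pmx_lin p q r s k (L : {linear 'M[R]_(p, q) -> 'M[R]_(r, s)})
    (A : 'rV[R]_n -> 'M[R]_(p, q)) x :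
  smooth_mx A -> D x -> pmx k (fun y => L (A y)) x = L (pmx k A x).
Proof.
move=> sA Dx; rewrite (funext (fun y => linear_mx_sum L (A y))) [RHS]linear_mx_sum.
have sC a b : smooth_mx (fun y => A y a b *: L (delta_mx a b)).
  exact/smooth_mxZ/smooth_mx_cst.
rewrite pmx_sum // => [|a]; last exact: smooth_mx_sum.
apply: eq_bigr => a _; rewrite pmx_sum //; apply: eq_bigr => b _.
by rewrite pmxZ ?pmx_cst ?scaler0 ?addr0 ?mxE //; exact: smooth_mx_cst.
Qed.

(** The Leibniz formula; with the adjugate it gives the smoothness of the
    inverse matrix. *)
Lemma smooth_on_det p (A : 'rV[R]_n -> 'M[R]_p) :
  smooth_mx A -> smooth_on D (fun y => \det (A y)).
Proof.
move=> sA; apply: (smooth_on_sum oD) => s; apply: (smooth_onM oD);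
  first exact: smooth_on_cst.
exact: (smooth_on_prod oD).
Qed.

Lemma smooth_mx_inv p (A : 'rV[R]_n -> 'M[R]_p) :
  (forall x, D x -> A x \in unitmx) -> smooth_mx A ->
  smooth_mx (fun y => invmx (A y)).
Proof.
move=> uA sA; apply: (@eq_smooth_mx _ _ _ (fun y => (\det (A y))^-1 *: \adj (A y))).
  by move=> x /set_mem Dx; rewrite /invmx uA.
apply: smooth_mxZ.
  apply: (smooth_onV oD); last exact: smooth_on_det.
  by move=> x /uA; rewrite unitmxE unitfE.
move=> i j; under [X in smooth_on D X]funext do rewrite mxE.
apply: (smooth_onM oD); first exact: smooth_on_cst.
apply: smooth_on_det => a b; under [X in smooth_on D X]funext do rewrite !mxE.
exact: sA.
Qed.

Lemma smooth_mx_block p q r s (A : 'rV[R]_n -> 'M[R]_(p, q))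
    (B : 'rV[R]_n -> 'M[R]_(p, s)) (C : 'rV[R]_n -> 'M[R]_(r, q))
    (E : 'rV[R]_n -> 'M[R]_(r, s)) :
  smooth_mx A -> smooth_mx B -> smooth_mx C -> smooth_mx E ->
  smooth_mx (fun y => block_mx (A y) (B y) (C y) (E y)).
Proof.
move=> sA sB sC sE i j; rewrite -[i]splitK -[j]splitK.
case: (fintype.split i) => a; case: (fintype.split j) => b /=.
- by under [X in smooth_on D X]funext do rewrite block_mxEul; apply: sA.
- by under [X in smooth_on D X]funext do rewrite block_mxEur; apply: sB.
- by under [X in smooth_on D X]funext do rewrite block_mxEdl; apply: sC.
- by under [X in smooth_on D X]funext do rewrite block_mxEdr; apply: sE.
Qed.

Lemma pmx_block p q r s k (A : 'rV[R]_n -> 'M[R]_(p, q))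
    (B : 'rV[R]_n -> 'M[R]_(p, s)) (C : 'rV[R]_n -> 'M[R]_(r, q))
    (E : 'rV[R]_n -> 'M[R]_(r, s)) x :
  pmx k (fun y => block_mx (A y) (B y) (C y) (E y)) x =
  block_mx (pmx k A x) (pmx k B x) (pmx k C x) (pmx k E x).
Proof.
apply/matrixP => i j; rewrite -[i]splitK -[j]splitK.
case: (fintype.split i) => a; case: (fintype.split j) => b /=.
- by rewrite block_mxEul !mxE; congr partial; apply/funext => y;
  rewrite block_mxEul.
- by rewrite block_mxEur !mxE; congr partial; apply/funext => y;
  rewrite block_mxEur.
- by rewrite block_mxEdl !mxE; congr partial; apply/funext => y;
  rewrite block_mxEdl.
- by rewrite block_mxEdr !mxE; congr partial; apply/funext => y;
  rewrite block_mxEdr.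
Qed.

End MatrixCalculus.

(** * The Levi-Civita connection *)

Section LeviCivita.
Context {R : realType} {n : nat}.
Implicit Types (g : 'rV[R]_n -> 'M[R]_n) (x : 'rV[R]_n).

(** The rows of [conn_mx g k x] are the covariant derivatives along d_k of the
    coordinate fields d_j. With vectors as rows, matrix products then compose
    from left to right. *)
Definition conn_mx g (k : 'I_n) x : 'M[R]_n := \matrix_(j, s) christoffel g s k j x.

(** Uniqueness of the torsion-free metric connection, at a single point: the
    cyclic sum defining the Christoffel symbols leaves twice one term once
    each derivative of g is expressed through W. It lets a connection be
    guessed in closed form and recognised by its two properties. *)
Lemma conn_unique g (W : 'I_n -> 'M[R]_n) x : g x \in unitmx ->
  (forall i j s, W i j s = W j i s) ->
  (forall k, pmx k g x = W k *m g x + g x *m (W k)^T) -> (g x)^T = g x ->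
  forall k, conn_mx g k x = W k.
Proof.
move=> ug Wsym Wg gS k; apply/matrixP => j h; rewrite mxE.
have gE a b : g x a b = g x b a by rewrite -{1}gS mxE.
have dg i a b : partial i (fun y => g y a b) x =
    (W i *m g x) a b + (W i *m g x) b a.
  transitivity (pmx i g x a b); first by rewrite mxE.
  rewrite Wg mxE; congr (_ + _); rewrite !mxE; apply: eq_bigr => c _.
  by rewrite mxE gE mulrC.
have Tsym a b c : (W a *m g x) b c = (W b *m g x) a c.
  by rewrite !mxE; apply: eq_bigr => d _; rewrite Wsym.
rewrite /christoffel; transitivity (((W k *m g x) *m invmx (g x)) j h).
  rewrite mxE mulr_sumr; apply: eq_bigr => m _; rewrite !dg.
  rewrite (Tsym m k j) (Tsym m j k) (Tsym j k m).
  have -> : invmx (g x) h m = invmx (g x) m h.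
    by rewrite -{1}gS -trmx_inv mxE.
  by field.
by rewrite mulmxK.
Qed.

Let partial_entry_sym g x : (forall k, (pmx k g x)^T = pmx k g x) ->
  forall k a b, partial k (fun y => g y a b) x = partial k (fun y => g y b a) x.
Proof. by move=> gS k a b; have /matrixP/(_ a b) := gS k; rewrite !mxE. Qed.

Lemma christoffel_sym g x : (forall k, (pmx k g x)^T = pmx k g x) ->
  forall h i j, christoffel g h i j x = christoffel g h j i x.
Proof.
move=> /partial_entry_sym gP h i j; rewrite /christoffel; congr (_ * _).
by apply: eq_bigr => m _; rewrite (gP m i j) (addrC (partial i _ x)).
Qed.

(** The lowered Christoffel symbols [L] are half the cyclic sum of derivatives
    of g, and two of them add up to one derivative. *)
Lemma conn_metric g x k : g x \in unitmx -> (g x)^T = g x ->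
  (forall k, (pmx k g x)^T = pmx k g x) ->
  pmx k g x = conn_mx g k x *m g x + g x *m (conn_mx g k x)^T.
Proof.
move=> ug gS /partial_entry_sym gP.
pose L j m := 2^-1 * (partial k (fun y => g y m j) x
  + partial j (fun y => g y m k) x - partial m (fun y => g y k j) x).
have LE : conn_mx g k x *m g x = \matrix_(j, m) L j m.
  rewrite -[RHS](mulmxKV ug); congr (_ *m _); apply/matrixP => j h.
  rewrite !mxE /christoffel mulr_sumr; apply: eq_bigr => m _.
  have -> : invmx (g x) h m = invmx (g x) m h by rewrite -{1}gS -trmx_inv mxE.
  by rewrite mxE /L; ring.
have -> : g x *m (conn_mx g k x)^T =
  (conn_mx g k x *m g x)^T by rewrite trmx_mul gS.
rewrite LE; apply/matrixP => a b; rewrite !mxE /L.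
by rewrite (gP k b a) (gP b k a) (gP a k b); field.
Qed.

Lemma pmx_sym (D : set 'rV[R]_n) g x k : open D -> smooth_mx D g ->
  (forall y, D y -> (g y)^T = g y) -> D x -> (pmx k g x)^T = pmx k g x.
Proof.
move=> oD sg gS Dx; rewrite -(pmx_lin oD k trmx) //.
by apply: (eq_pmx_in oD); rewrite ?inE // => y /set_mem; exact: gS.
Qed.

Lemma smooth_christoffel (D : set 'rV[R]_n) g h i j : open D -> smooth_mx D g ->
  (forall y, D y -> g y \in unitmx) -> smooth_on D (christoffel g h i j).
Proof.
move=> oD sg ug; apply: (smooth_onM oD); first exact: smooth_on_cst.
apply: (smooth_on_sum oD) => k; apply: (smooth_onM oD); first exact: smooth_mx_inv.
have sd c d e : smooth_on D (partial c (fun y => g y d e))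
  by exact: smooth_on_partial.
by apply: (smooth_onD oD); [exact: (smooth_onD oD)|exact: (smooth_onN oD)].
Qed.

Lemma smooth_conn (D : set 'rV[R]_n) g k : open D -> smooth_mx D g ->
  (forall y, D y -> g y \in unitmx) -> smooth_mx D (conn_mx g k).
Proof.
move=> oD sg ug j s; under [X in smooth_on D X]funext do rewrite mxE.
exact: smooth_christoffel.
Qed.

End LeviCivita.

(** * Scalar curvature in a moving frame *)

Section MovingFrame.
Context {R : realType} {n : nat} (D : set 'rV[R]_n) (oD : open D).
Context (E : 'rV[R]_n -> 'M[R]_n).

(** Rows of E are the frame vectors e_a; this is the derivative along e_a. *)
Definition frame_pmx p q (a : 'I_n) (A : 'rV[R]_n -> 'M[R]_(p, q)) x :
  'M[R]_(p, q) :=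
  \sum_k E x a k *: pmx k A x.

(** [W a] has as rows the covariant derivatives along e_a of the frame vectors.
    The matrix below is the curvature endomorphism R(e_a, e_b), for a
    torsion-free connection: the sum over d is the term of the bracket
    [e_a, e_b], whose d-th component is the difference of the coefficients. *)
Definition frame_curv (W : 'I_n -> 'rV[R]_n -> 'M[R]_n) (a b : 'I_n) x : 'M[R]_n :=
  frame_pmx a (W b) x - frame_pmx b (W a) x
  - \sum_d (W a x b d - W b x a d) *: W d x
  + W b x *m W a x - W a x *m W b x.

Context (G Gh : 'rV[R]_n -> 'M[R]_n) (W : 'I_n -> 'rV[R]_n -> 'M[R]_n).
Hypothesis uE : forall x, D x -> E x \in unitmx.
Hypothesis sE : smooth_mx D E.
Hypothesis sGh : smooth_mx D Gh.
Hypothesis sW : forall a, smooth_mx D (W a).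
Hypothesis GhE : forall x, D x -> Gh x = E x *m G x *m (E x)^T.
Hypothesis Gsym : forall x, D x -> (G x)^T = G x.
Hypothesis uG : forall x, D x -> G x \in unitmx.
Hypothesis torsion : forall x, D x -> forall a b s,
  (W a x *m E x) b s - (W b x *m E x) a s =
    frame_pmx a E x b s - frame_pmx b E x a s.
Hypothesis metric : forall x, D x -> forall a,
  frame_pmx a Gh x = W a x *m Gh x + Gh x *m (W a x)^T.

(* [w k] and [Om k] are the same connection along the coordinate field d_k,
   written in the frame and in coordinates respectively: the usual gauge
   transformation E Om = w E - dE relates them. *)
Let T x := invmx (E x).
Let w k x := \sum_a T x k a *: W a x.
Let Om k x := T x *m (w k x *m E x - pmx k E x).

Let sT : smooth_mx D T. Proof. exact: smooth_mx_inv. Qed.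

Let sw k : smooth_mx D (w k).
Proof. by apply: smooth_mx_sum => // a; apply: smooth_mxZ => //; apply: sT. Qed.

Let sOm k : smooth_mx D (Om k).
Proof.
apply: (smooth_mxM oD) => //; apply: (smooth_mxB oD); last exact: smooth_mx_pmx.
exact: (smooth_mxM oD).
Qed.

Lemma sum_coframe (p q : nat) (A : 'I_n -> 'M[R]_(p, q)) x k : D x ->
  \sum_a T x k a *: (\sum_l E x a l *: A l) = A k.
Proof.
move=> Dx; transitivity (\sum_l (T x *m E x) k l *: A l).
  rewrite (eq_bigr (fun a => \sum_l (T x k a * E x a l) *: A l)) => [|a _].
    by rewrite exchange_big; apply: eq_bigr => l _; rewrite mxE scaler_suml.
  by rewrite scaler_sumr; apply: eq_bigr => l _; rewrite scalerA.
rewrite mulVmx ?uE // (bigD1 k) //= mxE eqxx scale1r big1 ?addr0 // => l.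
by rewrite mxE eq_sym => /negPf ->; rewrite scale0r.
Qed.

Lemma sum_frame (p q : nat) (A : 'I_n -> 'M[R]_(p, q)) x a : D x ->
  \sum_l E x a l *: (\sum_b T x l b *: A b) = A a.
Proof.
move=> Dx; transitivity (\sum_b (E x *m T x) a b *: A b).
  rewrite (eq_bigr (fun l => \sum_b (E x a l * T x l b) *: A b)) => [|l _].
    by rewrite exchange_big; apply: eq_bigr => b _; rewrite mxE scaler_suml.
  by rewrite scaler_sumr; apply: eq_bigr => b _; rewrite scalerA.
rewrite mulmxV ?uE // (bigD1 a) //= mxE eqxx scale1r big1 ?addr0 // => b.
by rewrite mxE eq_sym => /negPf ->; rewrite scale0r.
Qed.

Let EOm k x : D x -> E x *m Om k x = w k x *m E x - pmx k E x.
Proof. by move=> Dx; rewrite mulKVmx // uE. Qed.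

(** Contracting both lower indices with the frame turns the symmetry of the
    coordinate coefficients into the torsion equation. *)
Let Om_sym x : D x -> forall i j s, Om i x j s = Om j x i s.
Proof.
move=> Dx i j s; pose M := \matrix_(k, l) Om k x l s.
suff /matrixP/(_ j i) : M^T = M by rewrite [LHS]mxE /M [LHS]mxE [RHS]mxE.
have XE a b : (E x *m M *m (E x)^T) a b = (W a x *m E x) b s - frame_pmx a E x b s.
  transitivity (\sum_k E x a k * (E x *m Om k x) b s).
    rewrite -mulmxA mxE; apply: eq_bigr => k _; congr (_ * _).
    by rewrite !mxE; apply: eq_bigr => l _; rewrite !mxE mulrC.
  transitivity ((\sum_k E x a k *: (w k x *m E x - pmx k E x)) b s).
    by rewrite summxE; apply: eq_bigr => k _; rewrite EOm // [RHS]mxE.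
  rewrite /frame_pmx; under eq_bigr do rewrite scalerBr scalemxAl.
  by rewrite sumrB -mulmx_suml sum_frame // !mxE.
have XS : (E x *m M *m (E x)^T)^T = E x *m M *m (E x)^T.
  apply/matrixP => a b; rewrite mxE !XE.
  have /eqP := torsion Dx a b s; rewrite subr_eq => /eqP ->; ring.
have MX : M = T x *m (E x *m M *m (E x)^T) *m (T x)^T.
  by rewrite !mulmxA mulVmx ?uE // mul1mx -mulmxA -trmx_mul mulVmx ?uE //
    trmx1 mulmx1.
by rewrite MX trmx_mul trmxK trmx_mul XS mulmxA.
Qed.

Let pmxT k x : D x -> pmx k T x *m E x = - (T x *m pmx k E x).
Proof.
move=> Dx; apply/eqP; rewrite -addr_eq0 -(pmxM (D := D)) //; apply/eqP.
rewrite -[RHS](pmx_cst k (1%:M : 'M[R]_n) x); apply: (eq_pmx_in oD _);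
  last by rewrite inE.
by move=> y /set_mem Dy; rewrite mulVmx // uE.
Qed.

Let pmxGh k x : D x -> pmx k Gh x = w k x *m Gh x + Gh x *m (w k x)^T.
Proof.
move=> Dx; rewrite -(sum_coframe (fun k => pmx k Gh x) k Dx) linear_sum /=.
rewrite mulmx_suml mulmx_sumr -big_split; apply: eq_bigr => a _ /=.
by rewrite -/(frame_pmx a Gh x) metric // linearZ /= -scalemxAl -scalemxAr scalerDr.
Qed.

Let GE x : D x -> G x = T x *m Gh x *m (T x)^T.
Proof.
move=> Dx; rewrite GhE // !mulmxA mulVmx ?uE // mul1mx -mulmxA -trmx_mul.
by rewrite mulVmx ?uE // trmx1 mulmx1.
Qed.

Let pmxG k x : D x -> pmx k G x = Om k x *m G x + G x *m (Om k x)^T.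
Proof.
move=> Dx; have sGh' : smooth_mx D (fun y => T y *m Gh y) by exact: smooth_mxM.
have sTt : smooth_mx D (fun y => (T y)^T) by apply: (smooth_mx_lin oD trmx).
rewrite (eq_pmx_in oD k (B := fun y => T y *m Gh y *m (T y)^T)) ?inE //; last first.
  by move=> y /set_mem; exact: GE.
rewrite !(pmxM (D := D)) // (pmx_lin oD k trmx) // pmxGh //=.
have e1 : Gh x *m (T x)^T = E x *m G x.
  by rewrite GhE // -mulmxA -trmx_mul mulVmx ?uE // trmx1 mulmx1.
have e2 : T x *m Gh x = G x *m (E x)^T.
  by apply: trmx_inj; rewrite !trmx_mul trmxK Gsym // -e1 GhE //
    !trmx_mul trmxK Gsym // mulmxA.
have e3 : pmx k T x *m Gh x *m (T x)^T = - (T x *m pmx k E x *m G x).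
  by rewrite -mulmxA e1 mulmxA pmxT // mulNmx.
have e4 : T x *m Gh x *m (pmx k T x)^T = - (G x *m (T x *m pmx k E x)^T).
  by rewrite e2 -mulmxA -trmx_mul pmxT // linearN /= mulmxN.
have e5 : T x *m (w k x *m E x) = Om k x + T x *m pmx k E x.
  by rewrite /Om mulmxBr subrK.
have e6 : T x *m (w k x *m Gh x) *m (T x)^T = (Om k x + T x *m pmx k E x) *m G x.
  by rewrite -e5 -!mulmxA e1 -?mulmxA.
have e7 : T x *m (Gh x *m (w k x)^T) *m (T x)^T =
    G x *m (Om k x + T x *m pmx k E x)^T.
  by rewrite -e5 !trmx_mul !mulmxA e2.
rewrite mulmxDl e4 e3 mulmxDr mulmxDl e6 e7 mulmxDl linearD mulmxDr /=.
move: (Om k x *m G x) (G x *m (Om k x)^T) => A B.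
by rewrite addrA [- _ + _]addrC addrK -addrA addrK.
Qed.

Let conn_frame k x : D x -> conn_mx G k x = Om k x.
Proof.
move=> Dx; apply: (conn_unique (W := fun k => Om k x)); rewrite ?uG ?Gsym //;
  last by move=> l; exact: pmxG.
exact: Om_sym.
Qed.

Let Rm (r l : 'I_n) x := pmx r (Om l) x - pmx l (Om r) x +
  Om l x *m Om r x - Om r x *m Om l x.

Let riemannE r l j s x : D x -> riemann G r l j s x = Rm r l x j s.
Proof.
move=> Dx; have cE a b c y : D y -> christoffel G a b c y = Om b y c a.
  by move=> Dy; rewrite -conn_frame // mxE.
rewrite /riemann; under eq_bigr do rewrite !cE //.
rewrite sumrB addrA.
rewrite (eq_partial_in r (G := fun y => Om l y j s) oD) ?inE //; last first.
  by move=> y /set_mem; exact: cE.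
rewrite (eq_partial_in l (G := fun y => Om r y j s) oD) ?inE //; last first.
  by move=> y /set_mem; exact: cE.
rewrite /Rm !mxE; congr (_ - _ + _ - _); by apply: eq_bigr => a _; rewrite mulrC.
Qed.

Let Q (r l : 'I_n) x := pmx r (w l) x - pmx l (w r) x +
  w l x *m w r x - w r x *m w l x.

(** Gauge covariance of the curvature. The mixed second derivatives of the frame
    are kept: only a trace of their difference enters the scalar curvature,
    and that trace is easily seen to vanish for frames that are linear along
    the fibres of a bundle. *)
Let ERm r l x : D x -> E x *m Rm r l x =
  Q r l x *m E x - (pmx r (pmx l E) x - pmx l (pmx r E) x).
Proof.
move=> Dx.
(* Derivative of the defining relation E Om_b + d_b E = w_b E. *)
have dEO a b : pmx a E x *m Om b x + E x *m pmx a (Om b) x + pmx a (pmx b E) x =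
    pmx a (w b) x *m E x + w b x *m pmx a E x.
  have sP : smooth_mx D (pmx b E) by exact: smooth_mx_pmx.
  have sEO : smooth_mx D (fun y => E y *m Om b y) by exact: (smooth_mxM oD).
  rewrite -!(pmxM (D := D)) // -(pmxD (D := D)) //.
  apply: (eq_pmx_in oD _); last by rewrite inE.
  by move=> y /set_mem Dy; rewrite EOm // subrK.
have d1 a b : E x *m pmx a (Om b) x = pmx a (w b) x *m E x
    + w b x *m pmx a E x - pmx a (pmx b E) x - pmx a E x *m Om b x.
  by rewrite -dEO addrK addrAC subrr add0r.
have d2 a b : E x *m (Om a x *m Om b x) = w a x *m (w b x *m E x)
   - w a x *m pmx b E x - pmx a E x *m Om b x.
  rewrite (mulmxA (E x) (Om a x)) EOm // mulmxBl -(mulmxA (w a x) (E x)).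
  by rewrite EOm // mulmxBr.
have dl (X A B A' B' : 'M[R]_n) :
    X *m (A - B + A' - B') = X *m A - X *m B + X *m A' - X *m B'.
  by rewrite mulmxBr mulmxDr mulmxBr.
have dr (X A B A' B' : 'M[R]_n) :
    (A - B + A' - B') *m X = A *m X - B *m X + A' *m X - B' *m X.
  by rewrite mulmxBl mulmxDl mulmxBl.
have -> : Q r l x *m E x = pmx r (w l) x *m E x - pmx l (w r) x *m E x
    + w l x *m (w r x *m E x) - w r x *m (w l x *m E x).
  by rewrite (mulmxA (w l x)) (mulmxA (w r x)); exact: dr.
have -> : E x *m Rm r l x = E x *m pmx r (Om l) x - E x *m pmx l (Om r) x
    + E x *m (Om l x *m Om r x) - E x *m (Om r x *m Om l x).
  exact: dl.
have cancel (x1 x2 x3 x4 a1 a2 a3 a4 a5 a6 a7 a8 a9 a10 : 'M[R]_n) :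
    x1 = a1 + a3 - a5 - a7 -> x2 = a2 + a4 - a6 - a8 ->
    x3 = a9 - a3 - a8 -> x4 = a10 - a4 - a7 ->
    x1 - x2 + x3 - x4 = a1 - a2 + a9 - a10 - (a5 - a6).
  by move=> -> -> -> ->; apply/matrixP => i j; rewrite !mxE; ring.
exact: cancel (d1 r l) (d1 l r) (d2 l r) (d2 r l).
Qed.

Let Q_frame a c x : D x ->
  \sum_r \sum_l (E x c r * E x a l) *: Q r l x = frame_curv W c a x.
Proof.
move=> Dx.
have WE b y : D y -> W b y = \sum_l E y b l *: w l y.
  by move=> Dy; rewrite sum_frame.
have fW b d : frame_pmx d (W b) x = \sum_r \sum_l (E x d r * E x b l) *:
  pmx r (w l) x
    + \sum_l frame_pmx d E x b l *: w l x.
  have sEw l : smooth_mx D (fun y => E y b l *: w l y).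
    by apply: smooth_mxZ => //; exact: sE.
  have -> : \sum_l frame_pmx d E x b l *: w l x =
      \sum_r \sum_l (E x d r * pmx r E x b l) *: w l x.
    rewrite exchange_big; apply: eq_bigr => l _.
    by rewrite -scaler_suml summxE; congr (_ *: _); apply: eq_bigr => r _;
      rewrite mxE.
  rewrite -big_split; apply: eq_bigr => r _ /=.
  rewrite (eq_pmx_in oD r (B := fun y => \sum_l E y b l *: w l y)) ?inE //;
    last first.
    by move=> y /set_mem; exact: WE.
  rewrite (pmx_sum (D := D)) // scaler_sumr -big_split; apply: eq_bigr => l _ /=.
  rewrite (pmxZ (D := D)) // scalerDr !scalerA addrC; congr (_ + _ *: _).
  by rewrite mxE.
have cE : \sum_l frame_pmx c E x a l *: w l x - \sum_l frame_pmx a E x c l *: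
  w l x =
    \sum_d (W c x a d - W a x c d) *: W d x.
  rewrite -sumrB (eq_bigr (fun l => \sum_d ((W c x a d - W a x c d) * E x d l) *:
    w l x)).
    rewrite exchange_big; apply: eq_bigr => d _ /=.
    by rewrite [X in _ = _ *: X]WE // scaler_sumr; apply: eq_bigr => l _;
      rewrite scalerA.
  move=> l _; rewrite -scalerBl -torsion // -scaler_suml; congr (_ *: _).
  by rewrite !mxE -sumrB; apply: eq_bigr => d _; rewrite mulrBl.
have WW b d : W b x *m W d x = \sum_r \sum_l (E x b r * E x d l) *:
  (w r x *m w l x).
  rewrite !WE // mulmx_suml; apply: eq_bigr => r _; rewrite mulmx_sumr.
  by apply: eq_bigr => l _; rewrite -scalemxAl -scalemxAr scalerA.
rewrite /frame_curv -cE !fW !WW.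
rewrite (_ : forall A B C1 D1 : 'M[R]_n, A + B - (C1 + D1) - (B - D1) = A - C1);
  last first.
  by move=> A B C1 D1; apply/matrixP => i j; rewrite !mxE; ring.
rewrite [X in _ = _ - X + _ - _]exchange_big [X in _ = _ + X - _]exchange_big /=.
rewrite -sumrB -big_split -sumrB; apply: eq_bigr => r _ /=.
rewrite -sumrB -big_split -sumrB; apply: eq_bigr => l _ /=.
by rewrite (mulrC (E x a l)) -scalerBr -scalerDr -scalerBr.
Qed.

(** The metric is written as G = E^-1 Gh E^-T, so that contracting the
    curvature with G^-1 amounts to contracting its frame components with
    Gh^-1. The last hypothesis says that the divergence of the frame commutes
    with partial derivatives; it is what remains, after taking the trace, of
    the difference of second derivatives in the curvature of a gauge
    transformed connection. *)
Lemma scalar_curvature_frame x : D x ->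
  (forall b l, \sum_r pmx r (pmx l E) x b r = \sum_r pmx l (pmx r E) x b r) ->
  scalar_curvature G x =
  \sum_a \sum_b invmx (Gh x) a b * \sum_c frame_curv W c a x b c.
Proof.
move=> Dx Ediv; rewrite /scalar_curvature.
have uGh : Gh x \in unitmx by rewrite GhE // !unitmx_mul unitmx_tr uE ?uG.
have iG : invmx (G x) = (E x)^T *m invmx (Gh x) *m E x.
  have EG : E x *m G x = Gh x *m (T x)^T.
    by rewrite GhE // -[RHS]mulmxA -trmx_mul mulVmx ?uE // trmx1 mulmx1.
  rewrite -[RHS](mulmxK (uG Dx)) -(mulmxA _ (E x)) EG (mulmxA _ (Gh x)) mulmxKV //.
  by rewrite -trmx_mul mulVmx ?uE // trmx1 mul1mx.
transitivity (\sum_a \sum_b invmx (Gh x) a b *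
    \sum_l \sum_r E x a l * (E x *m Rm r l x) b r).
  transitivity (\sum_l \sum_j \sum_a \sum_b
      E x a l * invmx (Gh x) a b * E x b j * ricci G l j x).
    apply: eq_bigr => l _; apply: eq_bigr => j _; rewrite iG -mulmxA mxE mulr_suml.
    apply: eq_bigr => a _; rewrite !mxE mulr_sumr mulr_suml; apply: eq_bigr => b _.
    by rewrite !mulrA.
  rewrite (eq_bigr (fun l => \sum_a \sum_b \sum_j
      E x a l * invmx (Gh x) a b * E x b j * ricci G l j x)) => [|l _]; last first.
    rewrite exchange_big; apply: eq_bigr => a _; exact: exchange_big.
  rewrite exchange_big; apply: eq_bigr => a _; rewrite exchange_big.
  apply: eq_bigr => b _; rewrite mulr_sumr; apply: eq_bigr => l _.
  rewrite (eq_bigr (fun j => \sum_r E x a l * invmx (Gh x) a b * E x b j * Rm r l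
    x j r)).
    rewrite exchange_big mulr_sumr; apply: eq_bigr => r _.
    by rewrite mxE !mulr_sumr; apply: eq_bigr => j _;
      rewrite !mulrA (mulrC (E x a l)).
  by move=> j _; rewrite /ricci mulr_sumr; apply: eq_bigr => r _; rewrite riemannE.
apply: eq_bigr => a _; apply: eq_bigr => b _; congr (_ * _).
transitivity (\sum_l \sum_r E x a l * (Q r l x *m E x) b r).
  apply: eq_bigr => l _; rewrite -!mulr_sumr; congr (_ * _).
  have subE (A B C : 'M[R]_n) i j : (A - (B - C)) i j = A i j - B i j + C i j.
    by rewrite !mxE opprB addrA addrAC.
  under eq_bigr do rewrite ERm // subE.
  rewrite big_split sumrB /= -[LHS]addrA -[RHS]addr0; congr (_ + _).
  by apply/eqP; rewrite addrC subr_eq0; apply/eqP/esym/Ediv.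
under [RHS]eq_bigr => c _ do rewrite -Q_frame // summxE.
rewrite exchange_big [RHS]exchange_big /=.
apply: eq_bigr => r _; under [RHS]eq_bigr do rewrite summxE.
rewrite [RHS]exchange_big /=; apply: eq_bigr => l _.
rewrite mxE mulr_sumr; apply: eq_bigr => c _.
by rewrite [RHS]mxE mulrA mulrC mulrA.
Qed.

End MovingFrame.

(** * Functions pulled back from the base of a trivial bundle *)

Section Pullback.
Context {R : realType} {n m : nat} (U : set 'rV[R]_n) (oU : open U).

Definition over : set 'rV[R]_(n + m) := [set p | U (lsubmx p)].

Lemma open_over : open over.
Proof. by apply: open_comp oU => p _; exact: continuous_lsubmx. Qed.

(** The difference quotients of both sides are equal; likewise in the fibre
    directions. *)
Lemma partial_pull_base (F : 'rV[R]_n -> R) i :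
  partial (lshift m i) (fun p : 'rV[R]_(n + m) => F (lsubmx p)) =
  (fun p => partial i F (lsubmx p)).
Proof.
apply/funext => p; rewrite /partial /derive; congr (lim _).
suff -> : (fun h : R => h^-1 *:
  (F (lsubmx (h *: (delta_mx 0 (lshift m i) : 'rV[R]_(n + m)) + p)) - F (lsubmx p)))
    = (fun h : R => h^-1 *: (F (h *: (delta_mx 0 i : 'rV[R]_n) + lsubmx p) - F
      (lsubmx p))) by [].
apply/funext => h; congr (_ *: (F _ - _)); apply/rowP => j.
by rewrite !mxE eq_lshift.
Qed.

Lemma partial_pull_fibre (F : 'rV[R]_n -> R) a :
  partial (rshift n a) (fun p : 'rV[R]_(n + m) => F (lsubmx p)) = (fun=> 0).
Proof.
apply/funext => p; rewrite -[RHS](derive0 F (lsubmx p)) /partial /derive;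
  congr (lim _).
suff -> : (fun h : R => h^-1 *:
  (F (lsubmx (h *: (delta_mx 0 (rshift n a) : 'rV[R]_(n + m)) + p)) - F (lsubmx p)))
    = (fun h : R => h^-1 *: (F (h *: (0 : 'rV[R]_n) + lsubmx p) - F (lsubmx p)))
      by [].
apply/funext => h; congr (_ *: (F _ - _)); apply/rowP => j.
by rewrite !mxE eq_lrshift.
Qed.

Lemma smooth_on_pull (F : 'rV[R]_n -> R) :
  smooth_on U F -> smooth_on over (fun p => F (lsubmx p)).
Proof.
move=> /smooth_onP cF; apply/smooth_onP => k; move/(_ k): cF.
have dF (F' : 'rV[R]_n -> R) p : differentiable F' (lsubmx p) ->
    differentiable (fun p : 'rV[R]_(n + m) => F' (lsubmx p)) p.
  by move=> dF'; apply: differentiable_comp => //; exact: differentiable_lsubmx.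
elim: k F => [|k IH] F /= [dFU cF]; split => //.
- by move=> p Dp; apply: dF; exact: dFU.
- by move=> p Dp; apply: dF; exact: dFU.
move=> a; rewrite -[a]splitK; case: (fintype.split a) => i /=.
  by rewrite partial_pull_base; apply: IH.
by rewrite partial_pull_fibre; exact: ck_cst.
Qed.

Lemma smooth_mx_pull p q (A : 'rV[R]_n -> 'M[R]_(p, q)) :
  smooth_mx U A -> smooth_mx over (fun x => A (lsubmx x)).
Proof. by move=> sA i j; exact: (smooth_on_pull (sA i j)). Qed.

Lemma pmx_pull_base p q (A : 'rV[R]_n -> 'M[R]_(p, q)) i x :
  pmx (lshift m i) (fun y : 'rV[R]_(n + m) => A (lsubmx y)) x = pmx i A (lsubmx x).
Proof.
apply/matrixP => a b; rewrite !mxE.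
by rewrite (partial_pull_base (fun y => A y a b)).
Qed.

Lemma pmx_pull_fibre p q (A : 'rV[R]_n -> 'M[R]_(p, q)) a x :
  pmx (rshift n a) (fun y : 'rV[R]_(n + m) => A (lsubmx y)) x = 0.
Proof.
apply/matrixP => i j; rewrite !mxE.
by rewrite (partial_pull_fibre (fun y => A y i j)).
Qed.

Lemma smooth_mx_fibre : smooth_mx over (rsubmx : 'rV[R]_(n + m) -> 'rV[R]_m).
Proof.
move=> i j; rewrite [i]ord1.
under [X in smooth_on _ X]funext do rewrite mxE.
exact: smooth_on_coord.
Qed.

Lemma pmx_fibre k x :
  pmx k (rsubmx : 'rV[R]_(n + m) -> 'rV[R]_m) x = rsubmx (delta_mx 0 k).
Proof.
apply/matrixP => i j; rewrite [i]ord1 !mxE -(partial_coord k (rshift n j) x).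
by under [in LHS]eq_fun do rewrite mxE.
Qed.

End Pullback.

(** * Sasaki type metrics on vector bundles *)

Section VectorBundle.
Context {R : realType} {n m : nat} (U : set 'rV[R]_n) (oU : open U).
Context (H : 'rV[R]_n -> 'M[R]_n) (K : 'rV[R]_n -> 'M[R]_m).
Context (b : 'I_n -> 'rV[R]_n -> 'M[R]_m).
Hypothesis sH : smooth_mx U H.
Hypothesis sK : smooth_mx U K.
Hypothesis sb : forall i, smooth_mx U (b i).
Hypothesis Hsym : forall x, U x -> (H x)^T = H x.
Hypothesis uH : forall x, U x -> H x \in unitmx.
Hypothesis Ksym : forall x, U x -> (K x)^T = K x.
Hypothesis uK : forall x, U x -> K x \in unitmx.
(* A point of the total space is (x, v) with v a row; the covariant derivative
   of a section s is d_i s - s b_i, and K is parallel. *)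
Hypothesis bK : forall x, U x -> forall i,
  pmx i K x = - (b i x *m K x + K x *m (b i x)^T).

Notation D := (@over R n m U).
Notation pi p := (lsubmx (p : 'rV[R]_(n + m))).
Notation vv p := (rsubmx (p : 'rV[R]_(n + m))).

Let oD : open D := open_over oU.

(** Row i is the fibre component of the horizontal lift of d_i. *)
Definition hor (p : 'rV[R]_(n + m)) : 'M[R]_(n, m) :=
  \matrix_(i, a) (vv p *m b i (pi p)) 0 a.

Definition adapted_frame p : 'M[R]_(n + m) := block_mx 1%:M (hor p) 0 1%:M.

Definition bundle_curv i j x : 'M[R]_m :=
  pmx i (b j) x - pmx j (b i) x + b i x *m b j x - b j x *m b i x.

Notation E := adapted_frame.

Let Gh p : 'M[R]_(n + m) := block_mx (H (pi p)) 0 0 (K (pi p)).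

(* The Levi-Civita connection of the total space, in the adapted frame. The
   bracket of the lifts of d_i and d_j is vertical, equal to the row j of
   [FF i]. The covariant derivative of one lift along another adds half of it
   to the base connection, and [P i] is minus the adjoint of this half; the
   lift of d_i and a vertical field have the derivative [P i] in either order,
   up to the vertical term - b_i, and vertical fields are parallel along the
   fibres. *)
Let FF i p : 'M[R]_(n, m) := \matrix_(j, a) (vv p *m bundle_curv i j (pi p)) 0 a.
Let P i p : 'M[R]_(m, n) := - 2^-1 *: (K (pi p) *m (FF i p)^T *m invmx (H (pi p))).
Let Qm a p : 'M[R]_n := \matrix_(i, k) P i p a k.

Let W (a : 'I_(n + m)) p : 'M[R]_(n + m) :=
  match fintype.split a with
  | inl i => block_mx (conn_mx H i (pi p)) (2^-1 *: FF i p) (P i p) (- b i (pi p))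
  | inr a => block_mx (Qm a p) 0 0 0
  end.

Let Wl i : W (lshift m i) = fun p =>
  block_mx (conn_mx H i (pi p)) (2^-1 *: FF i p) (P i p) (- b i (pi p)).
Proof. by rewrite /W (unsplitK (inl i)). Qed.

Let Wr a : W (rshift n a) = fun p => block_mx (Qm a p) 0 0 0.
Proof. by rewrite /W (unsplitK (inr a)). Qed.

Let smooth_hor : smooth_mx D hor.
Proof.
move=> i a; under [X in smooth_on D X]funext do rewrite mxE.
exact: (smooth_mxM oD (@smooth_mx_fibre R n m U) (smooth_mx_pull (sb i))).
Qed.

Let smooth_bundle_curv i j : smooth_mx U (bundle_curv i j).
Proof.
have sd k l : smooth_mx U (pmx k (b l)) by exact: smooth_mx_pmx.
apply: (smooth_mxB oU); last exact: (smooth_mxM oU).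
by apply: (smooth_mxD oU); [exact: (smooth_mxB oU)|exact: (smooth_mxM oU)].
Qed.

Let smooth_FF i : smooth_mx D (FF i).
Proof.
move=> j a; under [X in smooth_on D X]funext do rewrite mxE.
apply: (smooth_mxM oD (@smooth_mx_fibre R n m U)).
exact: (smooth_mx_pull (smooth_bundle_curv i j)).
Qed.

Let smooth_P i : smooth_mx D (P i).
Proof.
apply: (smooth_mxZ oD); first exact: smooth_on_cst.
apply: (smooth_mxM oD); last exact: (smooth_mx_pull (smooth_mx_inv oU uH sH)).
apply: (smooth_mxM oD); first exact: (smooth_mx_pull sK).
exact: (smooth_mx_lin oD trmx).
Qed.

Let smooth_W a : smooth_mx D (W a).
Proof.
have s0 p q : smooth_mx D (fun=> 0 : 'M[R]_(p, q)) by exact: smooth_mx_cst.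
rewrite -[a]splitK; case: (fintype.split a) => c /=.
  rewrite Wl; apply: smooth_mx_block => //;
    first exact: (smooth_mx_pull (smooth_conn c oU sH uH)).
    by apply: (smooth_mxZ oD) => //; exact: smooth_on_cst.
  exact: (smooth_mx_pull (smooth_mxN oU (sb c))).
rewrite Wr; apply: smooth_mx_block => // i k.
by under [X in smooth_on D X]funext do rewrite mxE; exact: smooth_P.
Qed.

Let smooth_E : smooth_mx D E.
Proof. by apply: smooth_mx_block => //; exact: smooth_mx_cst. Qed.

Let uE p : E p \in unitmx.
Proof. by rewrite unitmxE det_ublock !det1 mulr1 unitr1. Qed.

Let frame_pmx_base p q (A : 'rV[R]_(n + m) -> 'M[R]_(p, q)) i x :
  frame_pmx E (lshift m i) A x =
  pmx (lshift m i) A x + \sum_a hor x i a *: pmx (rshift n a) A x.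
Proof.
rewrite /frame_pmx big_split_ord /=; congr (_ + _); last first.
  by apply: eq_bigr => a _; rewrite block_mxEur.
rewrite (bigD1 i) //= block_mxEul mxE eqxx scale1r big1 ?addr0 // => j ji.
by rewrite block_mxEul mxE eq_sym (negPf ji) scale0r.
Qed.

Let frame_pmx_fibre p q (A : 'rV[R]_(n + m) -> 'M[R]_(p, q)) a x :
  frame_pmx E (rshift n a) A x = pmx (rshift n a) A x.
Proof.
rewrite /frame_pmx big_split_ord /= big1 ?add0r => [|i _]; last first.
  by rewrite block_mxEdl mxE scale0r.
rewrite (bigD1 a) //= block_mxEdr mxE eqxx scale1r big1 ?addr0 // => c ca.
by rewrite block_mxEdr mxE eq_sym (negPf ca) scale0r.
Qed.

Let frame_pmx_pull_base p q (A : 'rV[R]_n -> 'M[R]_(p, q)) i x :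
  frame_pmx E (lshift m i) (fun y => A (pi y)) x = pmx i A (pi x).
Proof.
rewrite frame_pmx_base pmx_pull_base big1 ?addr0 // => a _.
by rewrite pmx_pull_fibre scaler0.
Qed.

Let frame_pmx_block p q r s k (A : 'rV[R]_(n + m) -> 'M[R]_(p, q))
    (B : 'rV[R]_(n + m) -> 'M[R]_(p, s)) (C : 'rV[R]_(n + m) -> 'M[R]_(r, q))
    (F : 'rV[R]_(n + m) -> 'M[R]_(r, s)) x :
  frame_pmx E k (fun y => block_mx (A y) (B y) (C y) (F y)) x =
  block_mx (frame_pmx E k A x) (frame_pmx E k B x) (frame_pmx E k C x)
    (frame_pmx E k F x).
Proof.
rewrite /frame_pmx; under eq_bigr do rewrite pmx_block scale_block_mx.
apply/matrixP => i j; rewrite summxE -[i]splitK -[j]splitK.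
case: (fintype.split i) => c; case: (fintype.split j) => d /=.
- by under eq_bigr do rewrite block_mxEul; rewrite block_mxEul summxE.
- by under eq_bigr do rewrite block_mxEur; rewrite block_mxEur summxE.
- by under eq_bigr do rewrite block_mxEdl; rewrite block_mxEdl summxE.
- by under eq_bigr do rewrite block_mxEdr; rewrite block_mxEdr summxE.
Qed.

Let pmx_horl k x : D x -> pmx (lshift m k) hor x =
  \matrix_(i, c) (vv x *m pmx k (b i) (pi x)) 0 c.
Proof.
move=> Dx; apply/matrixP => i c; rewrite !mxE.
transitivity (pmx (lshift m k) (fun p => vv p *m b i (pi p)) x 0 c).
  by rewrite mxE; under [in LHS]eq_fun do rewrite mxE.
rewrite (pmxM (D := D)) //; [|exact: smooth_mx_fibre|exact:
  (smooth_mx_pull (sb i))].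
rewrite pmx_fibre pmx_pull_base (_ : rsubmx _ = 0) ?mul0mx ?add0r ?mxE //.
by apply/matrixP => ? ?; rewrite !mxE eq_rlshift andbF.
Qed.

Let pmx_horr a x : D x -> pmx (rshift n a) hor x = \matrix_(i, c) b i (pi x) a c.
Proof.
move=> Dx; apply/matrixP => i c; rewrite !mxE.
transitivity (pmx (rshift n a) (fun p => vv p *m b i (pi p)) x 0 c).
  by rewrite mxE; under [in LHS]eq_fun do rewrite mxE.
rewrite (pmxM (D := D)) //; [|exact: smooth_mx_fibre|exact:
  (smooth_mx_pull (sb i))].
rewrite pmx_fibre pmx_pull_fibre (_ : rsubmx _ = delta_mx 0 a).
  by rewrite mulmx0 addr0 -rowE mxE.
by apply/matrixP => ? ?; rewrite !mxE eq_rshift.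
Qed.

Let frame_pmx_hor i j x a : D x ->
  frame_pmx E (lshift m i) hor x j a - frame_pmx E (lshift m j) hor x i a =
    FF i x j a.
Proof.
move=> Dx; have fh k l c : frame_pmx E (lshift m k) hor x l c =
    (vv x *m (pmx k (b l) (pi x) + b k (pi x) *m b l (pi x))) 0 c.
  rewrite frame_pmx_base pmx_horl // mulmxDr mxE [in RHS]mxE; congr (_ + _).
    by rewrite mxE.
  rewrite summxE mulmxA mxE; apply: eq_bigr => d _.
  by rewrite pmx_horr // !mxE.
have mxB (A B : 'rV[R]_m) : A 0 a - B 0 a = (A - B) 0 a by rewrite !mxE.
rewrite !fh mxB -mulmxBr [RHS]mxE; congr ((_ *m _) _ _).
by rewrite /bundle_curv opprD addrACA addrA.
Qed.

Let frame_pmx_E k x : frame_pmx E k E x = block_mx 0 (frame_pmx E k hor x) 0 0.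
Proof.
have z p q (A : 'M[R]_(p, q)) : frame_pmx E k (fun=> A) x = 0.
  by rewrite /frame_pmx big1 // => i _; rewrite pmx_cst scaler0.
by rewrite frame_pmx_block !z.
Qed.

Let WlE i x : W (lshift m i) x *m E x = block_mx (conn_mx H i (pi x))
  (conn_mx H i (pi x) *m hor x + 2^-1 *: FF i x) (P i x)
    (P i x *m hor x - b i (pi x)).
Proof. by rewrite Wl mulmx_block !mulmx1 !mulmx0 !addr0. Qed.

Let WrE a x : W (rshift n a) x *m E x = block_mx (Qm a x) (Qm a x *m hor x) 0 0.
Proof. by rewrite Wr mulmx_block !mulmx1 !mulmx0 !mul0mx !addr0. Qed.

Let FF_asym i j x a : FF j x i a = - FF i x j a.
Proof.
rewrite !mxE -sumrN; apply: eq_bigr => c _; rewrite -mulrN; congr (_ * _).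
by rewrite !mxE; ring.
Qed.

Let conn_Hsym i j x k : U x -> conn_mx H i x j k = conn_mx H j x i k.
Proof.
by move=> Ux; rewrite !mxE; apply: christoffel_sym => l; exact: (pmx_sym _ oU).
Qed.

Let torsion x : D x -> forall a c s,
  (W a x *m E x) c s - (W c x *m E x) a s =
    frame_pmx E a E x c s - frame_pmx E c E x a s.
Proof.
move=> Dx a c s; rewrite !frame_pmx_E.
have PQ i k d : P i x d k = Qm d x i k by rewrite [RHS]mxE.
have PQh i k d : (P i x *m hor x) d k = (Qm d x *m hor x) i k.
  by rewrite !mxE; apply: eq_bigr => l _; rewrite PQ.
have mB p q (A B : 'M[R]_(p, q)) k l : (A - B) k l = A k l - B k l by rewrite !mxE.
have mxz p q k l : (0 : 'M[R]_(p, q)) k l = 0 by rewrite mxE.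
have D' : U (pi x) by [].
rewrite -[a]splitK -[c]splitK -[s]splitK.
case: (fintype.split a) => i; case: (fintype.split c) => j;
  case: (fintype.split s) => k /=; rewrite ?WlE ?WrE;
  rewrite ?(block_mxEul, block_mxEur, block_mxEdl, block_mxEdr).
- by rewrite (conn_Hsym j) // !mxE !subrr.
- have -> : frame_pmx E (lshift m i) hor x j k - frame_pmx E (lshift m j) hor x i
  k = FF i x j k.
    exact: frame_pmx_hor.
  have mD (A B : 'M[R]_(n, m)) p q : (A + 2^-1 *: B) p q = A p q + 2^-1 * B p q.
    by rewrite !mxE.
  rewrite !mD (FF_asym i j).
  have -> : (conn_mx H j (pi x) *m hor x) i k = (conn_mx H i (pi x) *m hor x) j k.
    by rewrite !mxE; apply: eq_bigr => l _; rewrite (conn_Hsym j).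
  by move: (_ j k) (FF i x j k) => y z; field.
- by rewrite PQ !mxE !subrr.
- rewrite frame_pmx_fibre pmx_horr // mB PQh mxz [X in _ = _ - X]mxE.
  by rewrite addrAC subrr.
- by rewrite PQ !mxE !subrr.
- rewrite frame_pmx_fibre pmx_horr // mB PQh mxz [X in _ = X - _]mxE.
  by rewrite opprB addrCA subrr addr0 subr0.
- by rewrite !mxE !subrr.
- by rewrite !mxE !subrr.
Qed.

Let metric x : D x -> forall a, frame_pmx E a Gh x =
  W a x *m Gh x + Gh x *m (W a x)^T.
Proof.
move=> Dx a; have Ux : U (pi x) by [].
have z p q k (A : 'M[R]_(p, q)) : frame_pmx E k (fun=> A) x = 0.
  by rewrite /frame_pmx big1 // => i _; rewrite pmx_cst scaler0.
have PH i : P i x *m H (pi x) = - (2^-1 *: (K (pi x) *m (FF i x)^T)).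
  by rewrite /P -scalemxAl mulmxKV ?uH // scaleNr.
have HP i : H (pi x) *m (P i x)^T = - (2^-1 *: (FF i x *m K (pi x))).
  by rewrite -[H _]Hsym // -trmx_mul PH linearN linearZ /= trmx_mul trmxK Ksym.
have QH d : Qm d x *m H (pi x) = \matrix_(i, j) (P i x *m H (pi x)) d j.
  by apply/matrixP => i j; rewrite !mxE; apply: eq_bigr => k _; rewrite mxE.
have QHa d : Qm d x *m H (pi x) + H (pi x) *m (Qm d x)^T = 0.
  have -> : H (pi x) *m (Qm d x)^T = (Qm d x *m H (pi x))^T.
    by rewrite trmx_mul Hsym.
  have QHE i j : (Qm d x *m H (pi x)) i j =
    - (2^-1 * \sum_c K (pi x) d c * FF i x j c).
    rewrite QH mxE PH mxE mxE mxE; congr (- (_ * _)).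
    by apply: eq_bigr => c _; rewrite [(FF i x)^T c j]mxE.
  apply/matrixP => i j; rewrite mxE [X in _ + X]mxE !QHE [RHS]mxE.
  under [X in _ + - (_ * X)]eq_bigr do rewrite FF_asym mulrN.
  by rewrite sumrN mulrN opprK addNr.
rewrite frame_pmx_block !z; rewrite -[a]splitK; case: (fintype.split a) => i /=.
  rewrite Wl tr_block_mx !mulmx_block add_block_mx !(mulmx0, mul0mx, addr0, add0r).
  rewrite PH HP !frame_pmx_pull_base bK // (conn_metric i) ?uH ?Hsym //; last first.
    by move=> k; exact: (pmx_sym _ oU).
  have -> : (2^-1 *: FF i x)^T = 2^-1 *: (FF i x)^T by rewrite linearZ.
  have -> : (- b i (pi x))^T = - (b i (pi x))^T by rewrite linearN.
  rewrite -scalemxAl subrr -scalemxAr addNr.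
  by rewrite (mulNmx (b i (pi x))) (mulmxN (K (pi x))) opprD.
rewrite Wr tr_block_mx !mulmx_block add_block_mx !trmx0
  !(mulmx0, mul0mx, addr0, add0r).
by rewrite QHa !frame_pmx_fibre !pmx_pull_fibre.
Qed.

(** Only the fibre components of the horizontal lifts vary, and they are linear
    in v: each derivative in a fibre direction commutes with the others by
    inspection. *)
Let E_div x : D x -> forall c l,
  \sum_r pmx r (pmx l E) x c r = \sum_r pmx l (pmx r E) x c r.
Proof.
move=> Dx c l.
have pE k y : pmx k E y = block_mx 0 (pmx k hor y) 0 0.
  by rewrite pmx_block !pmx_cst.
have ppE k k' : pmx k (pmx k' E) x = block_mx 0 (pmx k (pmx k' hor) x) 0 0.
  by rewrite (funext (pE k')) pmx_block !pmx_cst.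
suff hor_comm r : pmx (rshift n r) (pmx l hor) x = pmx l (pmx (rshift n r) hor) x.
  transitivity (\sum_r (block_mx 0 (pmx r (pmx l hor) x) 0 0 : 'M[R]_(n + m)) c r).
    by apply: eq_bigr => r _; rewrite -(ppE r l).
  transitivity (\sum_r (block_mx 0 (pmx l (pmx r hor) x) 0 0 : 'M[R]_(n + m)) c r).
    have blk (A B : 'M[R]_(n, m)) i : block_mx 0 A 0 0 c (lshift m i) =
        (block_mx 0 B 0 0 : 'M[R]_(n + m)) c (lshift m i).
      rewrite -[c]splitK; case: (fintype.split c) => d.
        by rewrite !block_mxEul.
      by rewrite !block_mxEdl.
    apply: eq_bigr => r _; rewrite -[r]splitK; case: (fintype.split r) => i.
      exact: blk.
    have blk2 (A B : 'M[R]_(n, m)) r' : A = B -> block_mx 0 A 0 0 c r' =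
        (block_mx 0 B 0 0 : 'M[R]_(n + m)) c r' by move=> ->.
    by apply: blk2; exact: hor_comm.
  by apply: eq_bigr => r _; rewrite -(ppE l r).
rewrite (eq_pmx_in oD l (B := fun y => \matrix_(i, c) b i (pi y) r c)) ?inE //;
  last first.
  by move=> y /set_mem; exact: pmx_horr.
rewrite -[l]splitK; case: (fintype.split l) => k /=.
  rewrite (eq_pmx_in oD _ (B :=
    fun y => \matrix_(i, c) (vv y *m pmx k (b i) (pi y)) 0 c)) ?inE //; last first.
    by move=> y /set_mem; exact: pmx_horl.
  apply/matrixP => i e; rewrite !mxE.
  transitivity (pmx (rshift n r) (fun p => vv p *m pmx k (b i) (pi p)) x 0 e).
    by rewrite mxE; under [in LHS]eq_fun do rewrite mxE.
  have sp : smooth_mx U (pmx k (b i)) by exact: smooth_mx_pmx.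
  rewrite (pmxM (D := D)) //; [|exact: smooth_mx_fibre|exact: (smooth_mx_pull sp)].
  rewrite pmx_fibre pmx_pull_fibre (_ : rsubmx _ = delta_mx 0 r).
    rewrite mulmx0 addr0 -rowE mxE.
    transitivity (pmx (lshift m k) (fun p => b i (pi p)) x r e).
      by rewrite pmx_pull_base.
    by rewrite mxE; under [in RHS]eq_fun do rewrite mxE.
  by apply/matrixP => ? ?; rewrite !mxE eq_rshift.
rewrite (eq_pmx_in oD _ (B := fun y => \matrix_(i, c) b i (pi y) k c)) ?inE //;
  last first.
  by move=> y /set_mem; exact: pmx_horr.
have z k1 k2 : pmx (rshift n k1) (fun y => \matrix_(i, c) b i (pi y) k2 c) x = 0.
  exact: (pmx_pull_fibre (fun y => \matrix_(i, c) b i y k2 c)).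
by rewrite !z.
Qed.

Let W_lll i j k x : W (lshift m i) x (lshift m j) (lshift m k) =
  conn_mx H i (pi x) j k.
Proof. by rewrite Wl block_mxEul. Qed.
Let W_llr i j c x : W (lshift m i) x (lshift m j) (rshift n c) = 2^-1 * FF i x j c.
Proof. by rewrite Wl block_mxEur mxE. Qed.
Let W_lrl i d k x : W (lshift m i) x (rshift n d) (lshift m k) = P i x d k.
Proof. by rewrite Wl block_mxEdl. Qed.
Let W_rll a i k x : W (rshift n a) x (lshift m i) (lshift m k) = P i x a k.
Proof. by rewrite Wr block_mxEul mxE. Qed.
Let W_rlr a i c x : W (rshift n a) x (lshift m i) (rshift n c) = 0.
Proof. by rewrite Wr block_mxEur mxE. Qed.
Let W_rr a d c x : W (rshift n a) x (rshift n d) c = 0.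
Proof.
by rewrite Wr -[c]splitK; case: (fintype.split c) => k;
  rewrite ?block_mxEdl ?block_mxEdr mxE.
Qed.

Let frame_pmx_Wl k i x : frame_pmx E k (W (lshift m i)) x =
  block_mx (frame_pmx E k (fun y => conn_mx H i (pi y)) x)
    (frame_pmx E k (fun y => 2^-1 *: FF i y) x)
    (frame_pmx E k (P i) x) (frame_pmx E k (fun y => - b i (pi y)) x).
Proof. by rewrite Wl frame_pmx_block. Qed.

Let frame_pmx_lll k i j l x : frame_pmx E (lshift m k) (W (lshift m i)) x
  (lshift m j) (lshift m l)
  = partial k (christoffel H l i j) (pi x).
Proof.
rewrite frame_pmx_Wl block_mxEul frame_pmx_pull_base mxE.
by under [in LHS]eq_fun do rewrite mxE.
Qed.

Let frame_pmx_llr c i j x : D x ->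
  frame_pmx E (rshift n c) (W (lshift m i)) x (lshift m j) (rshift n c)
  = 2^-1 * bundle_curv i j (pi x) c c.
Proof.
move=> Dx; rewrite frame_pmx_Wl block_mxEur frame_pmx_fibre.
rewrite (pmxZ (D := D)) //; last exact: smooth_on_cst.
rewrite partial_cst scale0r add0r mxE; congr (_ * _); rewrite mxE.
have sB := smooth_mx_pull (smooth_bundle_curv i j).
transitivity (pmx (rshift n c) (fun p => vv p *m bundle_curv i j (pi p)) x 0 c).
  by rewrite mxE; under [in LHS]eq_fun do rewrite mxE.
rewrite (pmxM (D := D)) //; [|exact: smooth_mx_fibre].
rewrite pmx_fibre pmx_pull_fibre mulmx0 addr0 (_ : rsubmx _ = delta_mx 0 c).
  by rewrite -rowE mxE.
by apply/matrixP => ? ?; rewrite !mxE eq_rshift.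
Qed.

Let frame_pmx_lrl k i d l x : frame_pmx E k (W (lshift m i)) x (rshift n d)
  (lshift m l) =
  frame_pmx E k (P i) x d l.
Proof. by rewrite frame_pmx_Wl block_mxEdl. Qed.

Let frame_pmx_Wr k a x : frame_pmx E k (W (rshift n a)) x =
  block_mx (frame_pmx E k (Qm a) x) 0 0 0.
Proof.
have z p q (A : 'M[R]_(p, q)) : frame_pmx E k (fun=> A) x = 0.
  by rewrite /frame_pmx big1 // => i _; rewrite pmx_cst scaler0.
by rewrite Wr frame_pmx_block !z.
Qed.

Let frame_pmx_rlr k a i c x : frame_pmx E k (W (rshift n a)) x (lshift m i)
  (rshift n c) = 0.
Proof. by rewrite frame_pmx_Wr block_mxEur mxE. Qed.

Let frame_pmx_rr k a c d x : frame_pmx E k (W (rshift n a)) x (rshift n c) d = 0.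
Proof.
by rewrite frame_pmx_Wr -[d]splitK; case: (fintype.split d) => l;
  rewrite ?block_mxEdl ?block_mxEdr mxE.
Qed.

Let frame_curvE c a d e x : frame_curv E W c a x d e =
  (frame_pmx E c (W a) x) d e - (frame_pmx E a (W c) x) d e
  - \sum_s (W c x a s - W a x c s) * W s x d e
  + \sum_s W a x d s * W c x s e - \sum_s W c x d s * W a x s e.
Proof.
have mBBDB p q (A1 A2 A3 A4 A5 : 'M[R]_(p, q)) i j :
    (A1 - A2 - A3 + A4 - A5) i j = A1 i j - A2 i j - A3 i j + A4 i j - A5 i j.
  by rewrite !mxE.
rewrite /frame_curv mBBDB; congr (_ - _ + _ - _); [|by rewrite mxE|by rewrite mxE].
by rewrite summxE; apply: eq_bigr => s _; rewrite mxE.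
Qed.

Let splitD (F : 'I_(n + m) -> R) :
  \sum_s F s = \sum_i F (lshift m i) + \sum_a F (rshift n a).
Proof. exact: big_split_ord. Qed.

Let M x i j := FF i x *m K (pi x) *m (FF j x)^T.

Let Masym1 x i j k l : M x i j k l = - M x k j i l.
Proof.
rewrite /M !mxE -sumrN; apply: eq_bigr => c _; rewrite -mulNr; congr (_ * _).
by rewrite !mxE -sumrN; apply: eq_bigr => d _; rewrite -mulNr FF_asym.
Qed.

Let FP x i j k l : (FF i x *m P j x) k l =
  - 2^-1 * \sum_s M x i j k s * invmx (H (pi x)) s l.
Proof. by rewrite /P -scalemxAr !mulmxA mxE; congr (_ * _); rewrite mxE. Qed.

Let hsym x i j : U (pi x) -> invmx (H (pi x)) i j = invmx (H (pi x)) j i.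
Proof. by move=> Ux; rewrite -{1}[H _]Hsym // -trmx_inv mxE. Qed.

(** The trace contracts a symmetric with an antisymmetric tensor. *)
Let trP x d : D x -> \sum_k P k x d k = 0.
Proof.
move=> Dx; have Ux : U (pi x) by [].
have PE k : P k x d k = - 2^-1 * \sum_l (K (pi x) *m (FF k x)^T) d l * invmx
  (H (pi x)) l k.
  by rewrite /P mxE; congr (_ * _); rewrite mxE.
rewrite (eq_bigr _ (fun k _ => PE k)) -mulr_sumr.
set X := \sum_k _; suff : X = - X by move=> /eqP;
  rewrite -addr_eq0 -mulr2n mulrn_eq0 /= => /eqP ->; rewrite mulr0.
rewrite {1}/X exchange_big /X -sumrN; apply: eq_bigr => k _ /=.
rewrite -sumrN; apply: eq_bigr => l _ /=; rewrite (hsym l k) // -mulNr;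
  congr (_ * _).
rewrite !mxE -sumrN; apply: eq_bigr => c _.
by rewrite ![(FF _ _)^T _ _]mxE (FF_asym k) mulrN.
Qed.

(** The next four lemmas take the trace of the curvature over horizontal (h) or
    vertical (v) directions, in horizontal or vertical arguments: first letter
    of the suffix for the argument, second for the trace. *)
Let curv_hh x i j : D x ->
  \sum_k frame_curv E W (lshift m k) (lshift m i) x (lshift m j) (lshift m k) =
  ricci H i j (pi x) - \sum_k (FF k x *m P j x) i k
  - 2^-1 * \sum_k (FF k x *m P i x) j k.
Proof.
move=> Dx; have Ux : U (pi x) by [].
rewrite (eq_bigr (fun k => riemann H k i j k (pi x) - (FF k x *m P j x) i k
   - 2^-1 * (FF k x *m P i x) j k + \sum_c 2^-1 * FF i x j c * P k x c k)).
  rewrite big_split /= exchange_big /= [X in _ + X = _]big1 ?addr0 => [|c _].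
    by rewrite !sumrB -mulr_sumr.
  by rewrite -mulr_sumr trP ?mulr0.
move=> k _; rewrite frame_curvE !splitD.
rewrite [\sum_s (_ - _) * _]big1 => [|s _]; last first.
  by rewrite !W_lll (conn_Hsym k) // subrr mul0r.
rewrite !frame_pmx_lll add0r.
have -> : \sum_s (W (lshift m k) x (lshift m i) (rshift n s)
    - W (lshift m i) x (lshift m k) (rshift n s)) *
    W (rshift n s) x (lshift m j) (lshift m k) = (FF k x *m P j x) i k.
  rewrite mxE; apply: eq_bigr => c _; rewrite !W_llr W_rll (FF_asym k i).
  by move: (FF k x i c) (P j x c k) => y z; field.
have -> : \sum_s W (lshift m k) x (lshift m j) (rshift n s) *
    W (lshift m i) x (rshift n s) (lshift m k) = 2^-1 * (FF k x *m P i x) j k.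
  rewrite mxE mulr_sumr; apply: eq_bigr => c _.
  by rewrite W_llr W_lrl mulrA.
under [\sum_a W _ x _ (rshift n a) * _]eq_bigr do rewrite W_llr W_lrl.
under [\sum_s W _ x _ (lshift m s) * _]eq_bigr do rewrite !W_lll.
under [X in _ - (X + _)]eq_bigr do rewrite !W_lll.
rewrite /riemann sumrB.
have cE i' j' k' : conn_mx H i' (pi x) j' k' =
  christoffel H k' i' j' (pi x) by rewrite mxE.
under [X in _ + (X + _) - _]eq_bigr do rewrite !cE mulrC.
under [X in _ - (X + _)]eq_bigr do rewrite !cE mulrC.
move: (partial k _ _) (partial i _ _) (\sum_(a < n) _) (\sum_(a < n) _)
  (\sum_(a < m) _) ((FF k x *m P j x) i k) (2^-1 * _) => y1 y2 y3 y4 y5 y6 y7.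
ring.
Qed.

Let curv_hv x i j : D x ->
  \sum_c frame_curv E W (rshift n c) (lshift m i) x (lshift m j) (rshift n c) =
  2^-1 * \sum_c bundle_curv i j (pi x) c c - 2^-1 * \sum_l (FF i x *m P j x) l l.
Proof.
move=> Dx; have -> : \sum_l (FF i x *m P j x) l l =
  \sum_c \sum_l P j x c l * FF i x l c.
  rewrite exchange_big; apply: eq_bigr => l _; rewrite mxE.
  by apply: eq_bigr => c _; rewrite mulrC.
rewrite !mulr_sumr -sumrB; apply: eq_bigr => c _.
rewrite frame_curvE !splitD frame_pmx_llr // frame_pmx_rlr subr0.
rewrite [\sum_s (_ - _) * _]big1 => [|s _]; last by rewrite W_rll W_lrl subrr mul0r.
rewrite [\sum_s (_ - _) * _]big1 => [|s _]; last by rewrite !W_rlr mulr0.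
rewrite [\sum_s _ * W (rshift n c) _ _ _]big1 => [|s _];
  last by rewrite W_rlr mulr0.
rewrite [\sum_s _ * W (rshift n c) _ _ _]big1 => [|s _]; last by rewrite W_rr mulr0.
rewrite [\sum_s W (rshift n c) _ _ (rshift n s) * _]big1 => [|s _];
  last by rewrite W_rlr mul0r.
rewrite !addr0 subr0; congr (_ - _).
rewrite mulr_sumr; apply: eq_bigr => l _.
by rewrite W_rll W_llr mulrCA.
Qed.

Let curv_vh x a d : D x ->
  \sum_k frame_curv E W (lshift m k) (rshift n a) x (rshift n d) (lshift m k) =
  - \sum_k \sum_l P k x d l * P l x a k.
Proof.
move=> Dx; have dtrP : \sum_k frame_pmx E (rshift n a) (P k) x d k = 0.
  under eq_bigr do rewrite frame_pmx_fibre mxE.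
  have dP k : differentiable (fun y => P k y d k) x
    by exact: (smooth_mx_diff _ _ (smooth_P k)).
  rewrite -partial_sum //.
  rewrite (eq_partial_in (rshift n a) (G := fun=> 0) oD) ?inE ?partial_cst //.
  by move=> y /set_mem Dy; exact: trP.
rewrite -[LHS]addr0 -[X in _ + X = _]dtrP -big_split -sumrN;
  apply: eq_bigr => k _ /=.
rewrite frame_curvE !splitD frame_pmx_lrl frame_pmx_rr sub0r.
rewrite [\sum_s (_ - _) * _]big1 => [|s _]; last by rewrite W_rll W_lrl subrr mul0r.
rewrite [\sum_s (_ - _) * _]big1 => [|s _]; last by rewrite W_rr mulr0.
rewrite [\sum_s W (rshift n a) _ (rshift n d) _ * _]big1 => [|s _];
  last by rewrite W_rr mul0r.
rewrite [\sum_s W (rshift n a) _ (rshift n d) _ * _]big1 => [|s _];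
  last by rewrite W_rr mul0r.
rewrite [\sum_s _ * W (rshift n a) _ (rshift n s) _]big1 => [|s _];
  last by rewrite W_rr mulr0.
rewrite !addr0 subr0 addrAC addNr add0r; congr (- _).
by apply: eq_bigr => l _; rewrite W_lrl W_rll.
Qed.

Let curv_vv x a d c : frame_curv E W (rshift n c) (rshift n a) x (rshift n d)
  (rshift n c) = 0.
Proof.
rewrite frame_curvE !splitD !frame_pmx_rr.
rewrite [\sum_s (_ - _) * _]big1 => [|s _]; last by rewrite !W_rr subrr mul0r.
rewrite [\sum_s (_ - _) * _]big1 => [|s _]; last by rewrite !W_rr subrr mul0r.
rewrite [X in _ + (X + _) - _]big1 => [|s _]; last by rewrite W_rr mul0r.
rewrite [X in _ + (_ + X) - _]big1 => [|s _]; last by rewrite W_rr mul0r.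
rewrite [X in _ - (X + _)]big1 => [|s _]; last by rewrite W_rr mul0r.
rewrite [X in _ - (_ + X)]big1 => [|s _]; last by rewrite W_rr mul0r.
by rewrite !addr0 !subr0.
Qed.

Let bundle_curv_asym i j x : bundle_curv j i x = - bundle_curv i j x.
Proof. by apply/matrixP => c d; rewrite !mxE; ring. Qed.

(** O'Neill's formula for a Riemannian submersion with flat totally geodesic
    fibres: the total space loses one fourth of the squared norm of the
    curvature of the connection applied to v. The four traces contribute
    - 1/2 - 1/4, + 1/4, + 1/4 and 0 times the contraction [S]. *)
Lemma scalar_curvature_bundle (G : 'rV[R]_(n + m) -> 'M[R]_(n + m)) :
  (forall p, D p -> E p *m G p *m (E p)^T = block_mx (H (pi p)) 0 0 (K (pi p))) ->
  forall p, D p -> scalar_curvature G p = scalar_curvature H (pi p) -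
    4^-1 * \sum_i \sum_j \sum_k \sum_l
      invmx (H (pi p)) i j * invmx (H (pi p)) k l *
      ((vv p *m bundle_curv i k (pi p)) *m K (pi p)
        *m (vv p *m bundle_curv j l (pi p))^T) 0 0.
Proof.
move=> EG.
have uGh p : D p -> Gh p \in unitmx.
  by move=> Dp; rewrite unitmxE det_ublock unitrM -!unitmxE uH // uK.
have GE p : D p -> G p = invmx (E p) *m Gh p *m (invmx (E p))^T.
  move=> Dp; rewrite /Gh -EG // !mulmxA mulVmx ?uE // mul1mx -mulmxA -trmx_mul.
  by rewrite mulVmx ?uE // trmx1 mulmx1.
have Ghsym p : D p -> (Gh p)^T = Gh p.
  by move=> Dp; rewrite tr_block_mx !trmx0 Hsym // Ksym.
have Gsym p : D p -> (G p)^T = G p.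
  by move=> Dp; rewrite GE // !trmx_mul trmxK Ghsym // mulmxA.
have uG p : D p -> G p \in unitmx.
  by move=> Dp; rewrite GE // !unitmx_mul unitmx_tr unitmx_inv uE uGh.
have smooth_Gh : smooth_mx D Gh.
  by apply: smooth_mx_block; [exact: smooth_mx_pull|exact: smooth_mx_cst|
    exact: smooth_mx_cst|exact: smooth_mx_pull].
have GhE p : D p -> Gh p = E p *m G p *m (E p)^T by move=> Dp; rewrite EG.
move=> p Dp; have Up : U (pi p) by [].
rewrite (scalar_curvature_frame oD (fun p _ => uE p) smooth_E smooth_Gh smooth_W GhE
  Gsym uG torsion metric Dp (E_div Dp)).
have iGh : invmx (Gh p) = block_mx (invmx (H (pi p))) 0 0 (invmx (K (pi p))).
  by rewrite invmx_block_diag // uGh.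
pose h := invmx (H (pi p)).
set S := \sum_i \sum_j \sum_k \sum_l _.
have SE : S = \sum_i \sum_j \sum_k \sum_l h i j * h k l * M p i j k l.
  apply: eq_bigr => i _; apply: eq_bigr => j _; apply: eq_bigr => k _.
  apply: eq_bigr => l _; congr (_ * _).
  have r q (X : 'rV[R]_m) (N : 'M[R]_(n, m)) :
    (forall c, X 0 c = N q c) -> X = row q N.
    by move=> XN; apply/rowP => c; rewrite XN mxE.
  rewrite (r k (vv p *m bundle_curv i k (pi p)) (FF i p)) => [|c];
    last by rewrite [RHS]mxE.
  rewrite (r l (vv p *m bundle_curv j l (pi p)) (FF j p)) => [|c];
    last by rewrite [RHS]mxE.
  by rewrite -row_mul tr_row [LHS]mxE /M [RHS]mxE; apply: eq_bigr => c _;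
    rewrite !mxE.
transitivity (\sum_i \sum_j h i j * (ricci H i j (pi p)
      - \sum_k (FF k p *m P j p) i k - 2^-1 * \sum_k (FF k p *m P i p) j k
      + (2^-1 * \sum_c bundle_curv i j (pi p) c c - 2^-1 * \sum_l
        (FF i p *m P j p) l l))
   + \sum_a \sum_d invmx (K (pi p)) a d * - \sum_k \sum_l P k p d l * P l p a k).
  rewrite splitD; congr (_ + _); apply: eq_bigr => i _; rewrite splitD.
    rewrite [X in _ + X = _]big1 ?addr0 => [|a _]; last first.
      by rewrite iGh block_mxEur mxE mul0r.
    apply: eq_bigr => j _; rewrite iGh block_mxEul; congr (_ * _).
    by rewrite splitD curv_hh // curv_hv.
  rewrite [X in X + _ = _]big1 ?add0r => [|j _]; last first.
    by rewrite iGh block_mxEdl mxE mul0r.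
  apply: eq_bigr => d _; rewrite iGh block_mxEdr; congr (_ * _).
  by rewrite splitD curv_vh // [X in _ + X]big1 ?addr0 // => c _; exact: curv_vv.
have hs i j : h i j = h j i by exact: hsym.
have e1 : \sum_i \sum_j h i j * (\sum_k (FF k p *m P j p) i k) = 2^-1 * S.
  rewrite SE mulr_sumr; apply: eq_bigr => i _; rewrite mulr_sumr;
    apply: eq_bigr => j _.
  rewrite !mulr_sumr; apply: eq_bigr => k _; rewrite FP !mulr_sumr;
    apply: eq_bigr => l _.
  by rewrite (Masym1 p k) -/h (hs l k); ring.
have e2 : \sum_i \sum_j h i j * (\sum_k (FF k p *m P i p) j k) = 2^-1 * S.
  rewrite -e1 exchange_big; apply: eq_bigr => i _; apply: eq_bigr => j _ /=.
  by rewrite hs.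
have e3 : \sum_i \sum_j h i j * (\sum_l (FF i p *m P j p) l l) = - (2^-1 * S).
  rewrite SE mulr_sumr -sumrN; apply: eq_bigr => i _; rewrite mulr_sumr -sumrN.
  apply: eq_bigr => j _; rewrite !mulr_sumr -sumrN; apply: eq_bigr => k _.
  rewrite FP !mulr_sumr -sumrN; apply: eq_bigr => l _.
  by rewrite -/h (hs l k); ring.
(* The trace of the curvature of the bundle is antisymmetric in i and j. *)
have e4 : \sum_i \sum_j h i j * (\sum_c bundle_curv i j (pi p) c c) = 0.
  set X := LHS; suff : X = - X.
    by move=> /eqP; rewrite -addr_eq0 -mulr2n mulrn_eq0 /= => /eqP.
  rewrite {1}/X exchange_big /X -sumrN; apply: eq_bigr => i _; rewrite -sumrN.
  apply: eq_bigr => j _; rewrite hs -mulrN; congr (_ * _); rewrite -sumrN.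
  by apply: eq_bigr => c _; rewrite bundle_curv_asym mxE.
have e5 : \sum_a \sum_d invmx (K (pi p)) a d *
  (\sum_k \sum_l P k p d l * P l p a k) =
    - (4^-1 * S).
  transitivity (\sum_k \sum_l ((P l p)^T *m invmx (K (pi p)) *m P k p) k l).
    rewrite (eq_bigr (fun a => \sum_k \sum_l \sum_d
        P l p a k * invmx (K (pi p)) a d * P k p d l)) => [|a _].
      rewrite exchange_big; apply: eq_bigr => k _; rewrite exchange_big.
      apply: eq_bigr => l _; rewrite exchange_big mxE; apply: eq_bigr => d _ /=.
      by rewrite [X in _ = X * _]mxE mulr_suml; apply: eq_bigr => a _;
        rewrite [(P l p)^T k a]mxE.
    rewrite (eq_bigr (fun d => \sum_k \sum_l
        P l p a k * invmx (K (pi p)) a d * P k p d l)) => [|d _].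
      by rewrite exchange_big; apply: eq_bigr => k _; exact: exchange_big.
    rewrite mulr_sumr; apply: eq_bigr => k _; rewrite mulr_sumr;
      apply: eq_bigr => l _.
    by ring.
  have PKP k l : (P l p)^T *m invmx (K (pi p)) *m P k p = 4^-1 *:
    (h *m M p l k *m h).
    have PT : (P l p)^T = - 2^-1 *: (h *m FF l p *m K (pi p)).
      rewrite /P linearZ /=; congr (_ *: _);
        rewrite !trmx_mul trmxK Ksym // trmx_inv.
      by rewrite Hsym // mulmxA.
    rewrite PT -!scalemxAl mulmxK ?uK // /P -scalemxAr scalerA.
    have -> : - 2^-1 * - 2^-1 = 4^-1 :> R by field.
    by rewrite /M !mulmxA.
  transitivity (\sum_k \sum_l \sum_s \sum_t 4^-1 * (h k s * M p l k s t * h t l)).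
    apply: eq_bigr => k _; apply: eq_bigr => l _;
      rewrite PKP mxE -mulmxA [X in _ * X]mxE mulr_sumr.
    apply: eq_bigr => s _; rewrite [X in _ * (_ * X)]mxE !mulr_sumr.
    by apply: eq_bigr => t _; rewrite (mulrA (h k s)).
  rewrite SE mulr_sumr -sumrN.
  rewrite (eq_bigr (fun k => \sum_s \sum_l \sum_t
    4^-1 * (h k s * M p l k s t * h t l))) => [|k _]; last exact: exchange_big.
  rewrite exchange_big; apply: eq_bigr => s _; rewrite mulr_sumr -sumrN.
  apply: eq_bigr => k _; rewrite mulr_sumr -sumrN; apply: eq_bigr => l _.
  rewrite mulr_sumr -sumrN; apply: eq_bigr => t _.
  by rewrite (Masym1 p s) (hs s k) (hs l t); ring.
have distr (A B C1 C2 C3 : 'I_n -> 'I_n -> R) :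
    \sum_i \sum_j h i j * (A i j - B i j - 2^-1 * C1 i j +
      (2^-1 * C2 i j - 2^-1 * C3 i j))
    = \sum_i \sum_j h i j * A i j - \sum_i \sum_j h i j * B i j
      - 2^-1 * \sum_i \sum_j h i j * C1 i j
      + (2^-1 * (\sum_i \sum_j h i j * C2 i j) - 2^-1 *
        (\sum_i \sum_j h i j * C3 i j)).
  rewrite !mulr_sumr -!sumrB -big_split; apply: eq_bigr => i _ /=.
  rewrite !mulr_sumr -!sumrB -big_split; apply: eq_bigr => j _ /=.
  by ring.
rewrite distr e1 e2 e3 e4.
under [X in _ + X]eq_bigr do (under eq_bigr do rewrite mulrN; rewrite sumrN).
rewrite sumrN e5 /scalar_curvature -/h.
by field.
Qed.

End VectorBundle.

(** * Conformal change of the metric *)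

Section ConformalScaling.
Context {R : realType} {n : nat} (U : set 'rV[R]_n) (oU : open U).
Context (g : 'rV[R]_n -> 'M[R]_n) (F : 'rV[R]_n -> R).
Hypothesis sg : smooth_mx U g.
Hypothesis gsym : forall x, U x -> (g x)^T = g x.
Hypothesis ug : forall x, U x -> g x \in unitmx.
Hypothesis sF : smooth_on U F.
Hypothesis F0 : forall x, U x -> F x != 0.

Let S h j i y := (2 * F y)^-1 * fA g F h j i y.
Let Fg y := F y *: g y.

Let invFg x : U x -> invmx (Fg x) = (F x)^-1 *: invmx (g x).
Proof.
by move=> Ux; rewrite invmxZ // /Fg unitmxZ ?ug // unitfE F0.
Qed.

(** Only the derivatives of F are new in the cyclic sum; dividing them by 2 F
    gives the tensor fA / (2 F). *)
Let christoffelZ h i j x : U x ->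
  christoffel Fg h i j x = christoffel g h i j x + S h i j x.
Proof.
move=> Ux; have F0x := F0 Ux.
have dFg k a b : partial k (fun y => Fg y a b) x =
    partial k F x * g x a b + F x * partial k (fun y => g y a b) x.
  have := pmxZ k sF sg Ux => /matrixP/(_ a b); rewrite !mxE => <-; exact: erefl.
have gd a : \sum_m invmx (g x) h m * g x m a = (h == a)%:R.
  by have := mulVmx (ug Ux) => /matrixP/(_ h a); rewrite !mxE.
rewrite /S /fA -!gd !mulr_sumr !mulr_suml -big_split -sumrB /christoffel /=.
rewrite !mulr_sumr -big_split; apply: eq_bigr => m _ /=.
rewrite !dFg invFg // mxE.
move: (partial i (fun y => g y m j) x) (partial j (fun y => g y m i) x)
  (partial m (fun y => g y i j) x) (partial i F x) (partial j F x) (partial m F x)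
  => d1 d2 d3 p1 p2 p3.
by field.
Qed.

Let smooth_S h j i : smooth_on U (S h j i).
Proof.
have sd k : smooth_on U (partial k F) by exact: smooth_on_partial.
apply: (smooth_onM oU).
  apply: (smooth_onV oU) => [x Ux|]; first by rewrite mulf_neq0 ?F0 // pnatr_eq0.
  by apply: (smooth_onM oU) => //; exact: smooth_on_cst.
apply: (smooth_onD oU).
  by apply: (smooth_onD oU); apply: (smooth_onM oU) => //; exact: smooth_on_cst.
apply: (smooth_onN oU); apply: (smooth_onM oU) => //.
by apply: (smooth_on_sum oU) => m; apply: (smooth_onM oU) => //;
  exact: smooth_mx_inv.
Qed.

Let christoffel_lower h i j x :
  U x -> christoffel g h i j x = christoffel g h j i x.
Proof. by move=> Ux; apply: christoffel_sym => k; exact: (pmx_sym k oU). Qed.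

(** Curvature of a connection changed by a symmetric tensor S: the cross terms
    between the connection and S complete the derivatives of S to covariant
    ones, as the symmetry of the Christoffel symbols cancels the two terms
    left over. *)
Let ricciZ l j x : U x -> ricci Fg l j x = ricci g l j x
  + (\sum_r covd g S r r l j x - \sum_r covd g S l r r j x
     + \sum_r \sum_s (4 * F x ^+ 2)^-1 * fA g F r r s x * fA g F s l j x
     - \sum_r \sum_s (4 * F x ^+ 2)^-1 * fA g F r l s x * fA g F s r j x).
Proof.
move=> Ux; have F0x := F0 Ux.
rewrite -!sumrB -big_split -sumrB -big_split; apply: eq_bigr => r _ /=.
have dC k a b c : partial k (christoffel Fg a b c) x =
    partial k (christoffel g a b c) x + partial k (S a b c) x.
  rewrite -partialD; [|exact: (smooth_on_diff (smooth_christoffel _ _ _ oU sg ug))|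
    exact: (smooth_on_diff (smooth_S _ _ _))].
  by apply: (eq_partial_in _ oU); rewrite ?inE // => y /set_mem;
    exact: christoffelZ.
pose cs k h i m := \sum_a (christoffel g h k a x * S a i m x
  - christoffel g a k i x * S h a m x - christoffel g a k m x * S h i a x).
have covdE k h i m : covd g S k h i m x = partial k (S h i m) x + cs k h i m by [].
pose qs G' := \sum_(a < n) (christoffel G' r r a x * christoffel G' a l j x
  - christoffel G' r l a x * christoffel G' a r j x).
have riemannE G' : riemann G' r l j r x = partial r (christoffel G' r l j) x
  - partial l (christoffel G' r r j) x + qs G' by [].
have -> : riemann Fg r l j r x = partial r (christoffel Fg r l j) x
  - partial l (christoffel Fg r r j) x + (qs g + cs r r l j - cs l r r j
  + \sum_s (4 * F x ^+ 2)^-1 * fA g F r r s x * fA g F s l j x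
  - \sum_s (4 * F x ^+ 2)^-1 * fA g F r l s x * fA g F s r j x).
  rewrite riemannE; congr (_ + _);
    rewrite /qs /cs -big_split -sumrB -big_split -sumrB.
  apply: eq_bigr => a _ /=; rewrite !christoffelZ // (christoffel_lower a l r) //
    /S.
  move: (fA g F r r a x) (fA g F a l j x) (fA g F r l a x) (fA g F a r j x)
    (fA g F r a j x) => A1 A2 A3 A4 A5.
  move: (christoffel g r r a x) (christoffel g a l j x) (christoffel g r l a x)
    (christoffel g a r j x) (christoffel g a r l x) => C1 C2 C3 C4 C5.
  by field.
rewrite !covdE riemannE !dC.
move: (qs g) (cs _ _ _ _) (cs _ _ _ _) (\sum_s _) (\sum_s _) => q c1 c2 q1 q2.
by move: (partial r _ x) (partial l _ x) (partial r _ x) (partial l _ x) => *; ring.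
Qed.

Lemma scalar_curvature_scale x : U x ->
  scalar_curvature Fg x = (F x)^-1 * scalar_curvature g x + fL g F x.
Proof.
move=> Ux; rewrite /fL -mulrDr -big_split mulr_sumr.
apply: eq_bigr => l _ /=; rewrite -big_split mulr_sumr; apply: eq_bigr => j _ /=.
by rewrite -mulrDr -ricciZ // invFg // mxE mulrA.
Qed.

End ConformalScaling.

(** * Contraction of the curvature acting on endomorphisms *)

Section Contraction.
Context {R : realType} {n : nat} (g t : 'M[R]_n) (kappa : R).
Hypothesis gsym : g^T = g.
Hypothesis ug : g \in unitmx.

Notation h := (invmx g).

Definition endo_dot (A B : 'M[R]_n) : R := \tr (h *m A^T *m g *m B).

(** The commutator of t with e_i e_k^T g. Antisymmetrized in i and k, it is, up
    to kappa, the action on t of the curvature of a space of constant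
    curvature. *)
Definition pair_endo (i k : 'I_n) : 'M[R]_n :=
  t *m delta_mx i k *m g - delta_mx i k *m g *m t.

Let hsym : h^T = h. Proof. by rewrite trmx_inv gsym. Qed.

Let hsymE i j : h i j = h j i. Proof. by rewrite -{1}hsym mxE. Qed.

Lemma endo_dotBr A B C : endo_dot A (B - C) = endo_dot A B - endo_dot A C.
Proof. by rewrite /endo_dot mulmxBr raddfB. Qed.

Lemma endo_dotBl A B C : endo_dot (A - B) C = endo_dot A C - endo_dot B C.
Proof. by rewrite /endo_dot raddfB mulmxBr !mulmxBl raddfB. Qed.

Lemma endo_dotBB A1 A2 B1 B2 : endo_dot (A1 - A2) (B1 - B2) =
  endo_dot A1 B1 - endo_dot A1 B2 - endo_dot A2 B1 + endo_dot A2 B2.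
Proof. by rewrite endo_dotBl !endo_dotBr; ring. Qed.

Lemma endo_dotZZ a A B : endo_dot (a *: A) (a *: B) = a ^+ 2 * endo_dot A B.
Proof.
have aT : (a *: A)^T = a *: A^T by rewrite linearZ.
by rewrite /endo_dot aT -!scalemxAr -!scalemxAl scalerA mxtraceZ.
Qed.

(** A trace of a product with two rank one factors splits into entries; this is
    how the contractions below reduce to products of two matrices. *)
Lemma mxtrace_delta2 (M N : 'M[R]_n) i j k l :
  \tr (delta_mx k i *m M *m delta_mx j l *m N) = M i j * N l k.
Proof.
rewrite -!mulmxA mxtrace_mulC -!mulmxA.
have -> : M *m (delta_mx j l *m (N *m delta_mx k i)) =
    col j M *m (row l N *m (delta_mx k i : 'M[R]_n)).
  rewrite -(mul_delta_mx (0 : 'I_1)) !mulmxA -colE -!mulmxA; congr (_ *m _).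
  by rewrite !mulmxA rowE.
rewrite mxtrace_mulC.
have -> : row l N *m delta_mx k i = N l k *: (delta_mx 0 i : 'rV[R]_n).
  rewrite -(mul_delta_mx (0 : 'I_1)) mulmxA -colE.
  by apply/rowP => b; rewrite !mxE big_ord1 !mxE.
by rewrite -scalemxAl -rowE linearZ /= /mxtrace big_ord1 !mxE mulrC.
Qed.

Let dotDD i k j l : endo_dot (pair_endo i k) (pair_endo j l) =
  (t^T *m g *m t) i j * g l k - (t^T *m g) i j * (g *m t) l k
  - (g *m t) i j * (t^T *m g) l k + g i j * (g *m t *m h *m t^T *m g) l k.
Proof.
rewrite /pair_endo endo_dotBB /endo_dot !trmx_mul !trmx_delta gsym.
congr (_ - _ - _ + _).
- by rewrite !mulmxA mulVmx // mul1mx -!mulmxA -mxtrace_delta2 !mulmxA.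
- by rewrite !mulmxA mulVmx // mul1mx -!mulmxA -mxtrace_delta2 !mulmxA.
- rewrite -mxtrace_delta2.
  have -> : h *m (t^T *m (g *m delta_mx k i)) *m g *m (t *m delta_mx j l *m g) =
     (h *m t^T *m g) *m (delta_mx k i *m (g *m t) *m delta_mx j l *m g)
       by rewrite !mulmxA.
  by rewrite mxtrace_mulC !mulmxA mulmxK.
- rewrite -mxtrace_delta2.
  have -> : h *m (t^T *m (g *m delta_mx k i)) *m g *m (delta_mx j l *m g *m t) =
     (h *m t^T *m g) *m (delta_mx k i *m g *m delta_mx j l *m g *m t)
       by rewrite !mulmxA.
  by rewrite mxtrace_mulC !mulmxA.
Qed.

(* Pairing i with j and k with l by h turns a product of entries into a product
   of traces when each factor carries one whole pair, and into one trace when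
   each pair is split between the factors. *)
Let contract1 (M N : 'M[R]_n) :
  \sum_i \sum_j \sum_k \sum_l h i j * h k l * (M i j * N l k) =
    \tr (h *m M) * \tr (h *m N).
Proof.
have -> : \tr (h *m M) = \sum_i \sum_j h i j * M i j.
  by rewrite exchange_big; apply: eq_bigr => i _; rewrite mxE;
    apply: eq_bigr => j _; rewrite hsymE.
have -> : \tr (h *m N) = \sum_k \sum_l h k l * N l k.
  by apply: eq_bigr => k _; rewrite mxE.
rewrite mulr_suml; apply: eq_bigr => i _; rewrite mulr_suml; apply: eq_bigr => j _.
rewrite mulr_sumr; apply: eq_bigr => k _; rewrite mulr_sumr; apply: eq_bigr => l _.
by ring.
Qed.

Let contract2 (M N : 'M[R]_n) :
  \sum_i \sum_j \sum_k \sum_l h i j * h k l * (M i l * N j k) =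
    \tr (M *m h *m N^T *m h).
Proof.
apply: eq_bigr => i _; rewrite mxE; apply: eq_bigr => j _.
rewrite mxE mulr_suml; apply: eq_bigr => k _.
rewrite mxE !mulr_suml; apply: eq_bigr => l _.
by rewrite mxE (hsymE i j) (hsymE k l); ring.
Qed.

Let trhg : \tr (h *m g) = n%:R. Proof. by rewrite mulVmx // mxtrace1. Qed.

Let contract (X : 'I_n -> 'I_n -> 'I_n -> 'I_n -> R) :=
  \sum_i \sum_j \sum_k \sum_l h i j * h k l * X i j k l.

Let contractB X Y : contract (fun i j k l => X i j k l - Y i j k l) =
  contract X - contract Y.
Proof.
rewrite -sumrB; apply: eq_bigr => i _; rewrite -sumrB; apply: eq_bigr => j _.
rewrite -sumrB; apply: eq_bigr => k _; rewrite -sumrB; apply: eq_bigr => l _.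
by rewrite mulrBr.
Qed.

Let contractD X Y : contract (fun i j k l => X i j k l + Y i j k l) =
  contract X + contract Y.
Proof.
rewrite -big_split; apply: eq_bigr => i _; rewrite -big_split;
  apply: eq_bigr => j _.
rewrite -big_split; apply: eq_bigr => k _; rewrite -big_split;
  apply: eq_bigr => l _.
by rewrite mulrDr.
Qed.

Let contractZ a X : contract (fun i j k l => a * X i j k l) = a * contract X.
Proof.
rewrite mulr_sumr; apply: eq_bigr => i _; rewrite mulr_sumr; apply: eq_bigr => j _.
rewrite mulr_sumr; apply: eq_bigr => k _; rewrite mulr_sumr; apply: eq_bigr => l _.
by rewrite mulrCA.
Qed.

Let contractC X : contract (fun i j k l => X k l i j) = contract X.
Proof.
rewrite /contract (Defs.exchange_sum4 (fun i j k l => h i j * h k l * X k l i j)).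
apply: eq_bigr => i _; apply: eq_bigr => j _; apply: eq_bigr => k _.
by apply: eq_bigr => l _; rewrite (mulrC (h k l)).
Qed.

Let eq_contract X Y : (forall i j k l, X i j k l = Y i j k l) ->
  contract X = contract Y.
Proof.
move=> XY; apply: eq_bigr => i _; apply: eq_bigr => j _; apply: eq_bigr => k _.
by apply: eq_bigr => l _; rewrite XY.
Qed.

Let contract_straight :
  contract (fun i j k l => endo_dot (pair_endo i k) (pair_endo j l)) =
  2 * n%:R * endo_dot t t - 2 * (\tr t) ^+ 2.
Proof.
rewrite (eq_contract (fun i j k l => dotDD i k j l)).
rewrite contractD !contractB /contract !contract1.
have -> : \tr (h *m (t^T *m g *m t)) = endo_dot t t by rewrite /endo_dot !mulmxA.
have -> : \tr (h *m (t^T *m g)) =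
  \tr t by rewrite mxtrace_mulC mulmxK // mxtrace_tr.
have -> : \tr (h *m (g *m t)) = \tr t by rewrite mulKmx.
have -> : \tr (h *m (g *m t *m h *m t^T *m g)) = endo_dot t t.
  by rewrite !mulmxA mulVmx // mul1mx -!mulmxA mxtrace_mulC /endo_dot !mulmxA.
by rewrite trhg; ring.
Qed.

Let contract_crossed :
  contract (fun i j k l => endo_dot (pair_endo i k) (pair_endo l j)) =
  2 * endo_dot t t - 2 * \tr (t *m t).
Proof.
rewrite (eq_contract (fun i j k l => dotDD i k l j)).
rewrite contractD !contractB /contract !contract2 !trmx_mul !trmxK gsym hsym.
have -> : \tr (t^T *m g *m t *m h *m g *m h) = endo_dot t t.
  by rewrite mulmxK // mxtrace_mulC /endo_dot !mulmxA.
have -> : \tr (t^T *m g *m h *m (t^T *m g) *m h) = \tr (t *m t).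
  by rewrite !mulmxA !mulmxK // -mxtrace_tr trmx_mul !trmxK.
have -> : \tr (g *m t *m h *m (g *m t) *m h) = \tr (t *m t).
  by rewrite mxtrace_mulC !mulmxA mulVmx // mul1mx mulmxKV.
have -> : \tr (g *m h *m (g *m (t *m (h *m (t^T *m g)))) *m h) = endo_dot t t.
  rewrite mulmxV // mul1mx mxtrace_mulC !mulmxA mulVmx // mul1mx.
  by rewrite /endo_dot -!mulmxA mxtrace_mulC !mulmxA.
by ring.
Qed.

(** Of the four terms obtained by antisymmetrizing both factors, two are
    [contract_straight] and two are [contract_crossed], up to exchanging the
    two contracted pairs. *)
Lemma contract_curvature :
  \sum_i \sum_j \sum_k \sum_l h i j * h k l *
    endo_dot (kappa *: (pair_endo i k - pair_endo k i))
      (kappa *: (pair_endo j l - pair_endo l j)) =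
  4 * kappa ^+ 2 * ((n%:R - 1) * endo_dot t t - ((\tr t) ^+ 2 - \tr (t *m t))).
Proof.
pose B i j k l := endo_dot (pair_endo i k) (pair_endo j l).
pose C i j k l := endo_dot (pair_endo i k) (pair_endo l j).
transitivity (contract (fun i j k l =>
    kappa ^+ 2 * (B i j k l - C i j k l - C k l i j + B k l i j))).
  by apply: eq_contract => i j k l; rewrite endo_dotZZ endo_dotBB.
rewrite contractZ contractD !contractB (contractC B) (contractC C).
by rewrite contract_straight contract_crossed; ring.
Qed.

End Contraction.

(** * The bundle of endomorphisms *)

Section EndomorphismBundle.
Context {R : realType} {n : nat} (U : set 'rV[R]_n) (oU : open U).
Context (g : 'rV[R]_n -> 'M[R]_n).
Hypothesis sg : smooth_mx U g.
Hypothesis gsym : forall x, U x -> (g x)^T = g x.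
Hypothesis ug : forall x, U x -> g x \in unitmx.

(** The Christoffel symbols with vectors as columns, the convention in which a
    (1,1)-tensor acts as an endomorphism. *)
Definition gamma (s : 'I_n) x : 'M[R]_n := (conn_mx g s x)^T.

(** The horizontal lift of d_s at t has fibre component t gamma_s - gamma_s t. *)
Definition endo_conn (s : 'I_n) x : 'M[R]_(n * n) :=
  lin_mx (mulmxr (gamma s x) \- mulmx (gamma s x)).

(** The map A |-> g A g^-1, which is the Gram matrix of the fibre metric since
    tr (g^-1 A^T g B) = tr ((g A g^-1)^T B). *)
Definition endo_metric x : 'M[R]_(n * n) :=
  lin_mx (mulmxr (invmx (g x)) \o mulmx (g x)).

Lemma mul_endo_conn A s x :
  mxvec A *m endo_conn s x = mxvec (A *m gamma s x - gamma s x *m A).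
Proof. exact: mul_vec_lin. Qed.

Lemma mul_endo_metric A x :
  mxvec A *m endo_metric x = mxvec (g x *m A *m invmx (g x)).
Proof. exact: mul_vec_lin. Qed.

Lemma endo_metric_sum A B x : U x -> (mxvec A *m endo_metric x *m (mxvec B)^T) 0 0 =
  \sum_i \sum_j \sum_k \sum_l g x i k * invmx (g x) j l * A i j * B k l.
Proof.
move=> Ux; rewrite mul_endo_metric Defs.mxvec_dot.
rewrite (Defs.exchange_sum4 (fun i j k l =>
  g x i k * invmx (g x) j l * A i j * B k l)).
apply: eq_bigr => k _; apply: eq_bigr => l _.
rewrite mxE mulr_suml exchange_big; apply: eq_bigr => j _ /=.
rewrite mxE !mulr_suml; apply: eq_bigr => i _.
have -> : g x k i = g x i k by rewrite -{1}(gsym Ux) mxE.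
by ring.
Qed.

Lemma mxvec_dot_tr (A B : 'M[R]_n) : (mxvec A *m (mxvec B)^T) 0 0 = \tr (A^T *m B).
Proof.
rewrite Defs.mxvec_dot exchange_big; apply: eq_bigr => j _; rewrite mxE.
by apply: eq_bigr => i _; rewrite mxE.
Qed.

Lemma endo_metric_dot A B x : U x ->
  (mxvec A *m endo_metric x *m (mxvec B)^T) 0 0 = endo_dot (g x) A B.
Proof.
move=> Ux; rewrite mul_endo_metric mxvec_dot_tr /endo_dot; congr (\tr (_ *m _)).
by rewrite !trmx_mul trmx_inv gsym // mulmxA.
Qed.

Lemma smooth_lin_mx (V : set 'rV[R]_n) p q r s
  (L : 'rV[R]_n -> 'M[R]_(p, q) -> 'M[R]_(r, s)) :
  open V -> (forall A, smooth_mx V (fun y => L y A)) ->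
    smooth_mx V (fun y => lin_mx (L y)).
Proof.
move=> oV sL i j; under [X in smooth_on V X]funext do rewrite mxE.
exact: (smooth_mx_lin oV mxvec (sL _)).
Qed.

Lemma smooth_gamma s : smooth_mx U (gamma s).
Proof. by apply: (smooth_mx_lin oU trmx); exact: smooth_conn. Qed.

Lemma smooth_comm_gamma A s : smooth_mx U
  (fun y => A *m gamma s y - gamma s y *m A).
Proof.
have sG := smooth_gamma s.
by apply: (smooth_mxB oU); apply: (smooth_mxM oU) => //; exact: smooth_mx_cst.
Qed.

Lemma smooth_endo_conn s : smooth_mx U (endo_conn s).
Proof. by apply: (smooth_lin_mx oU) => A; exact: smooth_comm_gamma. Qed.

Let sinv : smooth_mx U (fun y => invmx (g y)).
Proof. exact: smooth_mx_inv. Qed.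

Lemma smooth_conjg A : smooth_mx U (fun y => g y *m A *m invmx (g y)).
Proof.
by apply: (smooth_mxM oU) => //; apply: (smooth_mxM oU) => //; exact: smooth_mx_cst.
Qed.

Lemma smooth_endo_metric : smooth_mx U endo_metric.
Proof. by apply: (smooth_lin_mx oU) => A; exact: smooth_conjg. Qed.

(** Lets identities between operators on rows of length n * n be checked on
    n x n matrices. *)
Lemma eq_mxvec_mul p (M N : 'M[R]_(n * n, p)) :
  (forall A : 'M[R]_n, mxvec A *m M = mxvec A *m N) -> M = N.
Proof.
move=> MN; apply/row_matrixP => i; rewrite !rowE.
by rewrite -[delta_mx 0 i]vec_mxK MN.
Qed.

Lemma mulmx_pmx p q r k (A : 'M[R]_(p, q)) (B : 'rV[R]_n -> 'M[R]_(q, r)) x :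
  smooth_mx U B -> U x -> A *m pmx k B x = pmx k (fun y => A *m B y) x.
Proof.
move=> sB Ux; rewrite (pmxM (D := U)) //; last exact: smooth_mx_cst.
by rewrite pmx_cst mul0mx add0r.
Qed.

Lemma pmx_invmx k x : U x ->
  pmx k (fun y => invmx (g y)) x = - (invmx (g x) *m pmx k g x *m invmx (g x)).
Proof.
move=> Ux; rewrite -[LHS](mulmxK (ug Ux)) -mulNmx; congr (_ *m _).
apply/eqP; rewrite -addr_eq0 -(pmxM (D := U)) //; apply/eqP.
rewrite -[RHS](pmx_cst k (1%:M : 'M[R]_n) x); apply: (eq_pmx_in oU);
  last by rewrite inE.
by move=> y /set_mem Dy; rewrite mulVmx // ug.
Qed.

Lemma pmx_metric k x : U x -> pmx k g x = (gamma k x)^T *m g x + g x *m gamma k x.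
Proof.
move=> Ux; rewrite (conn_metric k (ug Ux) (gsym Ux)) /gamma ?trmxK //.
by move=> l; exact: (pmx_sym l oU).
Qed.

Lemma tr_endo_conn B s x :
  mxvec B *m (endo_conn s x)^T = mxvec (B *m (gamma s x)^T - (gamma s x)^T *m B).
Proof.
set C := _ - _; apply/rowP => k; case/mxvec_indexP: k => a b.
have dotE (u : 'rV[R]_(n * n)) :
    u 0 (mxvec_index a b) = (mxvec (delta_mx a b : 'M[R]_n) *m u^T) 0 0.
  by rewrite mxvec_delta -rowE !mxE.
rewrite !dotE trmx_mul trmxK mulmxA mul_endo_conn !mxvec_dot_tr /C.
have -> (X Y : 'M[R]_n) : (X - Y)^T = X^T - Y^T by apply/matrixP => ? ?;
  rewrite !mxE.
rewrite mulmxBl mulmxBr !raddfB /= !trmx_mul -!mulmxA; congr (_ - _).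
by rewrite mxtrace_mulC mulmxA.
Qed.

(** The fibre metric is parallel because g is. *)
Lemma pmx_endo_metric s x : U x -> pmx s endo_metric x =
  - (endo_conn s x *m endo_metric x + endo_metric x *m (endo_conn s x)^T).
Proof.
move=> Ux; apply: eq_mxvec_mul => A; rewrite mulmx_pmx //;
  last exact: smooth_endo_metric.
under [X in pmx _ X]funext do rewrite mul_endo_metric.
rewrite (pmx_lin oU s mxvec) //; last exact: smooth_conjg.
rewrite mulmxN mulmxDr !mulmxA mul_endo_conn !mul_endo_metric tr_endo_conn
  -linearD -linearN /=.
congr mxvec; have sgA : smooth_mx U (fun y => g y *m A).
  by apply: (smooth_mxM oU) => //; exact: smooth_mx_cst.
rewrite (pmxM (D := U)) // (pmxM (D := U)) //; last exact: smooth_mx_cst.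
rewrite pmx_cst mulmx0 addr0 pmx_invmx // pmx_metric //.
set X := gamma s x; set h := invmx (g x); set G := g x.
rewrite !(mulmxDl, mulmxDr, mulmxBl, mulmxBr, mulmxN, mulNmx) !mulmxA.
have -> : G *m A *m h *m X^T *m G *m h = G *m A *m h *m X^T by rewrite mulmxK // ug.
have -> : G *m A *m h *m G *m X *m h = G *m A *m X *m h by rewrite mulmxKV // ug.
move: (X^T *m G *m A *m h) (G *m X *m A *m h) (G *m A *m h *m X^T)
  (G *m A *m X *m h).
by move=> Y1 Y2 Y3 Y4; apply/matrixP => a b; rewrite !mxE; ring.
Qed.

Lemma gamma_curv i j x : U x ->
  pmx i (gamma j) x - pmx j (gamma i) x +
    gamma i x *m gamma j x - gamma j x *m gamma i x
  = \matrix_(s, k) riemann g i j k s x.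
Proof.
move=> Ux; have pG k l s m : pmx k (gamma l) x s m =
  partial k (christoffel g s l m) x.
  by rewrite mxE; under [in LHS]eq_fun do rewrite !mxE.
have mE (A B C E : 'M[R]_n) s k :
  (A - B + C - E) s k = A s k - B s k + C s k - E s k.
  by rewrite !mxE.
have add4 (a b c d a' b' q : R) : a = a' -> b = b' -> c - d = q ->
    a - b + c - d = a' - b' + q by move=> -> -> <-; rewrite addrA.
apply/matrixP => s k; rewrite [RHS]mxE; apply: etrans (mE _ _ _ _ s k) _.
apply: add4 (pG i j s k) (pG j i s k) _.
by rewrite sumrB; congr (_ - _); rewrite mxE; apply: eq_bigr => a _; rewrite !mxE.
Qed.

(** The induced connection acts by commutators, hence so does its curvature. *)
Lemma mul_bundle_curv A i j x : U x -> mxvec A *m bundle_curv endo_conn i j x =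
  mxvec (A *m (\matrix_(s, k) riemann g i j k s x)
    - (\matrix_(s, k) riemann g i j k s x) *m A).
Proof.
move=> Ux; rewrite -gamma_curv // /bundle_curv.
have pC k l : mxvec A *m pmx k (endo_conn l) x =
    mxvec (A *m pmx k (gamma l) x - pmx k (gamma l) x *m A).
  rewrite mulmx_pmx //; last exact: smooth_endo_conn.
  under [X in pmx _ X]funext do rewrite mul_endo_conn.
  rewrite (pmx_lin oU k mxvec) //; last exact: smooth_comm_gamma.
  congr mxvec; have sG := smooth_gamma l.
  pose L := mulmx A \- mulmxr A.
  by rewrite (pmx_lin oU k L).
have mE (X B C E : 'M[R]_(n * n)) (v : 'rV[R]_(n * n)) :
  v *m (X - B + C - E) = v *m X - v *m B + v *m C - v *m E.
  by rewrite mulmxBr mulmxDr mulmxBr.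
have CC k l : mxvec A *m (endo_conn k x *m endo_conn l x) =
    mxvec ((A *m gamma k x - gamma k x *m A) *m gamma l x - gamma l x
      *m (A *m gamma k x - gamma k x *m A)).
  by rewrite mulmxA !mul_endo_conn.
have add4 (a b c d a' b' c' d' e : 'rV[R]_(n * n)) : a = a' -> b = b' -> c = c' ->
    d = d' -> a' - b' + c' - d' = e -> a - b + c - d = e by move=> -> -> -> ->.
apply: etrans (mE _ _ _ _ _) _.
apply: add4 (pC i j) (pC j i) (CC i j) (CC j i) _.
have mv (X Y Z T : 'M[R]_n) :
    mxvec X - mxvec Y + mxvec Z - mxvec T = mxvec (X - Y + Z - T).
  by rewrite linearB linearD linearB.
apply: etrans (mv _ _ _ _) _; congr mxvec.
have alg (Gi Gj Pi Pj : 'M[R]_n) : A *m Pj - Pj *m A - (A *m Pi - Pi *m A)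
    + ((A *m Gi - Gi *m A) *m Gj - Gj *m (A *m Gi - Gi *m A))
    - ((A *m Gj - Gj *m A) *m Gi - Gi *m (A *m Gj - Gj *m A))
    = A *m (Pj - Pi + Gi *m Gj - Gj *m Gi) - (Pj - Pi + Gi *m Gj - Gj *m Gi) *m A.
  rewrite !(mulmxDl, mulmxDr, mulNmx, mulmxN) !mulmxA.
  move: (A *m Pj) (Pj *m A) (A *m Pi) (Pi *m A) (A *m Gi *m Gj) (Gi *m A *m Gj)
    (Gj *m A *m Gi) (Gj *m Gi *m A) (A *m Gj *m Gi) (Gi *m Gj *m A).
  by move=> *; apply/matrixP => a b; rewrite !mxE; ring.
exact: alg.
Qed.

Lemma endo_metric_sym x : U x -> (endo_metric x)^T = endo_metric x.
Proof.
move=> Ux; have dotC A B : endo_dot (g x) A B = endo_dot (g x) B A.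
  rewrite /endo_dot -[LHS]mxtrace_tr !trmx_mul trmxK gsym // trmx_inv gsym //.
  by rewrite !mulmxA mxtrace_mulC !mulmxA.
apply/Defs.mx_sym_bform => u v; rewrite -[u]vec_mxK -[v]vec_mxK.
by rewrite !endo_metric_dot.
Qed.

Lemma endo_metric_unit x : U x -> endo_metric x \in unitmx.
Proof.
move=> Ux; pose N : 'M[R]_(n * n) := lin_mx (mulmxr (g x) \o mulmx (invmx (g x))).
suff : endo_metric x *m N = 1%:M by case/mulmx1_unit.
apply: eq_mxvec_mul => A; rewrite mulmx1 mulmxA mul_endo_metric.
have -> B : mxvec B *m N = mxvec (invmx (g x) *m B *m g x) by exact: mul_vec_lin.
by rewrite !mulmxA mulVmx ?ug // mul1mx mulmxKV // ug.
Qed.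

Lemma hlift_hor p s :
  row_mx (delta_mx 0 s) (row s (hor endo_conn p)) =
  hlift g (lsubmx p) (vec_mx (rsubmx p)) (delta_mx 0 s).
Proof.
rewrite /hlift; congr row_mx.
have -> : row s (hor endo_conn p) = rsubmx p *m endo_conn s (lsubmx p).
  by apply/rowP => a; rewrite !mxE.
rewrite -{1}[rsubmx p]vec_mxK mul_endo_conn; congr mxvec.
set t := vec_mx _; apply/matrixP => i j; rewrite [RHS]mxE (bigD1 s) //=.
have eE s' : (delta_mx 0 s : 'rV[R]_n) 0 s' = (s' == s)%:R by rewrite mxE.
rewrite [X in _ = _ + X]big1 => [|s' ns]; last by rewrite eE (negPf ns) mul0r.
rewrite addr0 eE eqxx mul1r sumrB [LHS]mxE; congr (_ + _).
  by rewrite [LHS]mxE; apply: eq_bigr => m _; rewrite !mxE mulrC.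
rewrite [LHS]mxE; congr (- _).
by rewrite [LHS]mxE; apply: eq_bigr => m _; rewrite ![gamma _ _ _ _]mxE ?mxE.
Qed.

Lemma riemann_pair kappa i k x t : (forall k m j s, riemann g k m j s x =
     kappa * ((k == s)%:R * g x m j - (m == s)%:R * g x k j)) ->
  t *m (\matrix_(s, l) riemann g i k l s x) - (\matrix_(s, l) riemann g i k l s x)
    *m t =
  kappa *: (pair_endo (g x) t i k - pair_endo (g x) t k i).
Proof.
move=> gR; have -> : \matrix_(s, l) riemann g i k l s x =
    kappa *: (delta_mx i k *m g x - delta_mx k i *m g x).
  have dE a b : delta_mx a b *m g x = \matrix_(s, l) ((a == s)%:R * g x b l).
    rewrite -(mul_delta_mx (0 : 'I_1)) -mulmxA -rowE.
    by apply/matrixP => s l; rewrite !mxE big_ord1 !mxE andbT eq_sym.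
  by apply/matrixP => s l; rewrite !dE !mxE gR.
rewrite -scalemxAr -scalemxAl -scalerBr /pair_endo; congr (_ *: _).
by rewrite mulmxBr mulmxBl !mulmxA; apply/matrixP => a b; rewrite !mxE; ring.
Qed.

Lemma scalar_curvature_const kappa x : U x -> (forall k m j s, riemann g k m j s x =
     kappa * ((k == s)%:R * g x m j - (m == s)%:R * g x k j)) ->
  scalar_curvature g x = kappa * n%:R * (n%:R - 1).
Proof.
move=> Ux gR; have rE l j : ricci g l j x = kappa * (n%:R - 1) * g x l j.
  rewrite /ricci (eq_bigr (fun r => kappa * (g x l j - (l == r)%:R * g x r j))).
    rewrite -mulr_sumr sumrB sumr_const card_ord (bigD1 l) //= eqxx mul1r.
    rewrite big1 ?addr0 => [|r rl]; last by rewrite eq_sym (negPf rl) mul0r.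
    by rewrite -mulr_natl; ring.
  by move=> r _; rewrite gR eqxx mul1r.
transitivity (kappa * (n%:R - 1) * \tr (invmx (g x) *m g x)); last first.
  by rewrite mulVmx ?ug // mxtrace1; ring.
rewrite /scalar_curvature mulr_sumr; apply: eq_bigr => l _; rewrite mxE mulr_sumr.
apply: eq_bigr => j _; rewrite rE;
  have -> : g x j l = g x l j by rewrite -{1}(gsym Ux) mxE.
by ring.
Qed.

End EndomorphismBundle.

(** * The rescaled Sasaki type metric *)

Section AdaptedFrameRows.
Context {R : realType} {n m : nat} (b : 'I_n -> 'rV[R]_n -> 'M[R]_m).

Lemma row_frame_base i p :
  row (lshift m i) (adapted_frame b p) = row_mx (delta_mx 0 i) (row i (hor b p)).
Proof.
apply/rowP => a; rewrite mxE -[a]splitK; case: (fintype.split a) => k /=.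
  by rewrite block_mxEul row_mxEl !mxE eq_sym.
by rewrite block_mxEur row_mxEr !mxE.
Qed.

Lemma row_frame_fibre a p :
  row (rshift n a) (adapted_frame b p) = row_mx 0 (delta_mx 0 a).
Proof.
apply/rowP => c; rewrite mxE -[c]splitK; case: (fintype.split c) => k /=.
  by rewrite block_mxEdl row_mxEl !mxE.
by rewrite block_mxEdr row_mxEr !mxE eq_sym.
Qed.

End AdaptedFrameRows.

Lemma frame_gram (R : pzRingType) p q (E : 'M[R]_(p, q)) (G : 'M[R]_q) a b :
  (E *m G *m E^T) a b = (row a E *m G *m (row b E)^T) 0 0.
Proof. by rewrite tr_row colE mulmxA -!row_mul -colE [RHS]mxE [RHS]mxE. Qed.

Lemma posdef_unitmx (R : realFieldType) n (A : 'M[R]_n) :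
  (forall v : 'rV_n, v != 0 -> 0 < (v *m A *m v^T) 0 0) -> A \in unitmx.
Proof.
move=> Apos; rewrite -row_free_unit -kermx_eq0; apply/eqP/row_matrixP => i.
apply/eqP; rewrite row0; apply: contraT => /Apos.
by rewrite -row_mul mulmx_ker row0 mul0mx mxE ltxx.
Qed.

Section SasakiMetric.
Context {R : realType} {n : nat} {M : smoothManifold R n}.
Variables (g : riemMetric M) (f : M -> R).
Variable (G : chart M -> 'rV[R]_(n + n * n) -> 'M[R]_(n + n * n)).
Hypothesis hG : rescaled_sasaki g f G.

(** The rows of the adapted frame are the lifts of the coordinate fields and of
    the elementary matrices, on which the metric is prescribed. *)
Lemma sasaki_frame (c : chart M) p : over (chart_map c @` dom c) p ->
  adapted_frame (endo_conn (g c)) p *m G c p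
    *m (adapted_frame (endo_conn (g c)) p)^T
  = block_mx (f (point_at c (lsubmx p)) *: g c (lsubmx p)) 0 0
             (endo_metric (g c) (lsubmx p)).
Proof.
move=> Up; set E := adapted_frame _ p.
have gsym : forall y, (chart_map c @` dom c) y -> (g c y)^T = g c y.
  by move=> y; exact: gmx_sym.
have [Gsym Gvv Gvh Ghh] := hG (vec_mx (rsubmx p)) Up.
have pE : bundle_coord (lsubmx p) (vec_mx (rsubmx p)) = p.
  by rewrite /bundle_coord vec_mxK hsubmxK.
rewrite pE in Gsym Gvv Gvh Ghh.
have rowb i : row (lshift (n * n) i) E =
  hlift (g c) (lsubmx p) (vec_mx (rsubmx p)) (delta_mx 0 i).
  by rewrite row_frame_base; exact: hlift_hor.
have rowf a : row (rshift n a) E = vlift (vec_mx (delta_mx 0 a)).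
  by rewrite row_frame_fibre /vlift vec_mxK.
apply/matrixP => a d; rewrite frame_gram -[a]splitK -[d]splitK.
case: (fintype.split a) => i; case: (fintype.split d) => j /=; rewrite ?rowb ?rowf.
- rewrite Ghh block_mxEul [RHS]mxE; congr (_ * _).
  by rewrite -rowE trmx_delta -colE !mxE.
- by rewrite Gsym Gvh block_mxEur mxE.
- by rewrite Gvh block_mxEdl mxE.
- rewrite Gvv block_mxEdr -(endo_metric_sum gsym) // !vec_mxK.
  by rewrite -rowE trmx_delta -colE !mxE.
Qed.

End SasakiMetric.

Theorem theorem9 (R : realType) (n : nat) (hn : (2 < n)%N)
  (M : smoothManifold R n) (g : riemMetric M)
  (f : M -> R) (f_smooth : smooth_function f) (f_pos : forall x : M, 0 < f x)
  (kappa : R) (g_curv : constant_curvature g kappa)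
  (G : chart M -> 'rV[R]_(n + n * n) -> 'M[R]_(n + n * n))
  (hG : rescaled_sasaki g f G)
  (t : tensor11 M) (c : chart M) (hc : dom c (tbase t)) :
  let x := chart_map c (tbase t) in
  let gx := g c x in
  let fx := f (tbase t) in
  let tm := tcomp hc in
  let norm2 := \sum_(k < n) \sum_(l < n) \sum_(i < n) \sum_(j < n)
                 gx k l * invmx gx i j * tm k i * tm l j in
  scalar_curvature (G c) (induced_coord hc) =
    fx^-1 * (n%:R - 1) * kappa * (n%:R - fx^-1 * norm2 * kappa)
    + (fx ^+ 2)^-1 * kappa ^+ 2 * ((\tr tm) ^+ 2 - \tr (tm *m tm))
    + fL (g c) (f \o point_at c) x.
Proof.
move=> x gx fx tm norm2.
pose U := chart_map c @` dom c; have oU : open U by exact: chart_img_open.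
pose F := f \o point_at c.
have sg : smooth_mx U (g c) by move=> i j; exact: gmx_smooth.
have gsym y : U y -> (g c y)^T = g c y by move=> Uy; exact: gmx_sym.
have ug y : U y -> g c y \in unitmx.
  by move=> Uy; apply: posdef_unitmx => v; exact: gmx_pos.
have sF : smooth_on U F by exact: f_smooth.
have F0 y : U y -> F y != 0 by move=> _; rewrite gt_eqF // f_pos.
have Ux : U x by exists (tbase t).
have Fx : F x = fx by rewrite /F /x /= chart_cancel.
have fx0 : fx != 0 by rewrite gt_eqF // f_pos.
pose p := induced_coord hc.
have px : lsubmx p = x by rewrite /p /induced_coord /bundle_coord row_mxKl.
have pt : rsubmx p = mxvec tm by rewrite /p /induced_coord /bundle_coord row_mxKr.
have Dp : over U p by rewrite /over /= px.
have sH : smooth_mx U (fun y => F y *: g c y) by exact: smooth_mxZ.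
have Hsym y : U y -> (F y *: g c y)^T = F y *: g c y.
  by move=> Uy; rewrite linearZ /= gsym.
have uH y : U y -> F y *: g c y \in unitmx.
  by move=> Uy; rewrite unitmxZ ?ug // unitfE F0.
have EG := sasaki_frame hG (c := c).
rewrite -/p (scalar_curvature_bundle oU sH (smooth_endo_metric oU sg ug)
  (smooth_endo_conn oU sg ug) Hsym uH (fun y Uy => endo_metric_sym gsym Uy)
  (fun y Uy => endo_metric_unit ug Uy)
    (fun y Uy i => pmx_endo_metric oU sg gsym ug i Uy) EG Dp).
rewrite px pt (scalar_curvature_scale oU sg gsym ug sF F0 Ux).
rewrite (scalar_curvature_const gsym ug Ux (g_curv c x Ux)).
have -> : norm2 = endo_dot gx tm tm.
  rewrite -(endo_metric_dot gsym) // (endo_metric_sum gsym) //.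
  apply: eq_bigr => k _; rewrite exchange_big; apply: eq_bigr => l _.
  by apply: eq_bigr => i _; apply: eq_bigr => j _.
set S := \sum_i \sum_j \sum_k \sum_l _.
have -> : S = (fx ^+ 2)^-1 * (4 * kappa ^+ 2 * ((n%:R - 1) * endo_dot gx tm tm
    - ((\tr tm) ^+ 2 - \tr (tm *m tm)))).
  rewrite -(contract_curvature tm kappa (gsym x Ux) (ug x Ux)) /S.
  have iH : invmx (F x *: g c x) = fx^-1 *: invmx gx by rewrite invmxZ ?uH // Fx.
  rewrite iH mulr_sumr; apply: eq_bigr => i _; rewrite mulr_sumr;
    apply: eq_bigr => j _.
  rewrite mulr_sumr; apply: eq_bigr => k _; rewrite mulr_sumr;
    apply: eq_bigr => l _.
  have mb a d : mxvec tm *m bundle_curv (endo_conn (g c)) a d x =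
      mxvec (kappa *: (pair_endo gx tm a d - pair_endo gx tm d a)).
    rewrite (mul_bundle_curv oU sg ug) //; congr mxvec.
    by apply: riemann_pair; exact: g_curv.
  have eq_bform (X X' Y Y' : 'rV[R]_(n * n)) N : X = X' -> Y = Y' ->
      (X *m N *m Y^T) 0 0 = (X' *m N *m Y'^T) 0 0 by move=> -> ->.
  rewrite (eq_bform _ _ _ _ _ (mb i k) (mb j l)) (endo_metric_dot gsym) //.
  have hE a d : (fx^-1 *: invmx gx) a d = fx^-1 * invmx gx a d by rewrite mxE.
  rewrite !hE; move: (endo_dot _ _ _) (invmx gx i j) (invmx gx k l) => y h1 h2.
  by field.
by rewrite Fx; field.
Qed.
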